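(* Let $A\subseteq\mathcal{T}_n\setminus\mathcal{S}_n$ be an independent set and let $G\le\mathcal{S}_n$. The following are equivalent: (1) $\langle A\cup G\rangle\setminus G=\langle A\cup\mathcal{S}_n\rangle\setminus\mathcal{S}_n$; (2) $(a,G)$ is an $\mathcal{S}_n$-pair for every $a\in A$.
   Context: $\Omega=\{1,\ldots,n\}$, $\mathcal{T}_n$ is the monoid of all maps $\Omega\to\Omega$, $\mathcal{S}_n$ the symmetric group, $\langle\cdot\rangle$ the generated semigroup. A set $A\subseteq\mathcal{T}_n\setminus\mathcal{S}_n$ is independent if for all distinct $a,b\in A$ we have $a\notin\langle b,\mathcal{S}_n\rangle$. For $a\in\mathcal{T}_n\setminus\mathcal{S}_n$, $(a,G)$ is an $\mathcal{S}_n$-pair if $\langle a,G\rangle\setminus G=\langle a,\mathcal{S}_n\rangle\setminus\mathcal{S}_n$. *)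

(* Defs.v *)
From mathcomp Require Import all_boot all_fingroup.
Set Implicit Arguments. Unset Strict Implicit. Unset Printing Implicit Defensive.

Definition trans (n : nat) := {ffun 'I_n -> 'I_n}.

(* composition (apply g first, then f); the generated semigroup does not depend on the order convention *)
Definition tcomp n (f g : trans n) : trans n := [ffun i => f (g i)].

(* S_n as a subset of T_n: the bijective (equivalently injective) maps *)
Definition inSn n (f : trans n) : Prop := injective f.

Definition perm_trans n (p : {perm 'I_n}) : trans n := [ffun i => p i].

Inductive gen n (X : trans n -> Prop) : trans n -> Prop :=
| gen_base f : X f -> gen X f
| gen_comp f g : gen X f -> gen X g -> gen X (tcomp f g).

Definition inG n (G : {group {perm 'I_n}}) (f : trans n) : Prop :=
  exists2 p, p \in G & f = perm_trans p.

Definition withG n (X : trans n -> Prop) (G : {group {perm 'I_n}}) : trans n -> Prop :=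
  fun f => X f \/ inG G f.

Definition withSn n (X : trans n -> Prop) : trans n -> Prop :=
  fun f => X f \/ inSn f.

Definition independent n (A : trans n -> Prop) : Prop :=
  (forall a, A a -> ~ inSn a) /\
  (forall a b, A a -> A b -> a <> b -> ~ gen (withSn (fun f => f = b)) a).

Definition Sn_pair n (a : trans n) (G : {group {perm 'I_n}}) : Prop :=
  forall f,
    (gen (withG (fun h => h = a) G) f /\ ~ inG G f)
    <-> (gen (withSn (fun h => h = a)) f /\ ~ inSn f).

(* Main.v *)
Require Import Defs.
From mathcomp Require Import all_boot all_order all_algebra all_fingroup all_solvable zify.
Set Implicit Arguments. Unset Strict Implicit. Unset Printing Implicit Defensive.
(* [perm_trans] is also the transitivity of [perm_eq] in seq.v. *)
Import Defs.

(** Write [rank a] for the size of the image of [a].  Since [a] is singular, [<a, S_n> \ S_n]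
    consists of all maps [h \o a \o q] with [q] a permutation and [h] arbitrary, so independence says
    that the kernel types of the members of [A] form an antichain.  The pair [(a, G)] is an
    [S_n]-pair as soon as [G] is transitive on the kernels of the type of [a] and on the sets of size
    [rank a]: the images of [a] can then be moved like tokens on [n > rank a] places.

    Suppose (1).  The first letter from [A] in a word for [a \o q] must be [a], which gives
    transitivity on kernels; the last letter has rank at least [rank a], which gives transitivity on
    [rank a]-sets when [a] is the only member of [A] of maximal rank.  For the other members take a
    prime [p] with [n / 2 < p < n].  If the kernel of some [a] in [A] has all its classes, and its
    set of singleton classes, of size less than [p], then no [p]-cycle fixes that kernel, so [p]
    divides [#|G|] and [G] contains a [p]-cycle; as [G] is transitive, Jordan's argument makes it
    [(n - p + 1)]-transitive, and it contains a 3-cycle when [p <= n - 3], which Bertrand's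
    postulate allows for [n >= 8].  For [n <= 7] the transitivity is enough, except for [n = 6],
    where the kernel type [2 + 2 + 2] is treated by comparing two matchings.  If no kernel is of
    this kind, the theorem of Livingstone and Wagner (transitivity on [l]-sets implies transitivity
    on [k]-sets for [k <= l <= n - k]) and the antichain condition suffice. *)

(** * Bertrand's postulate *)

Lemma central_bin_step m : m.+1 * 'C(m.+1.*2, m.+1) = 2 * (m.*2.+1 * 'C(m.*2, m)).
Proof.
have h1 := mul_bin_diag (m.+1.*2) m.
have h2 := mul_bin_down (m.*2.+1) m.
rewrite doubleS /= in h1 h2 *.
have e : m.*2.+1 - m = m.+1 by lia.
rewrite e in h2; nia.
Qed.

Lemma central_bin_ge m : 0 < m -> 4 ^ m <= m.*2 * 'C(m.*2, m).
Proof.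
elim: m => // -[_ _|m IH _]; first by [].
have := central_bin_step m.+1; have := IH isT; rewrite (expnS 4 m.+1).
move: (4 ^ m.+1) => x h e.
have -> : m.+2.*2 * 'C(m.+2.*2, m.+2) = 2 * (m.+2 * 'C(m.+2.*2, m.+2)) by lia.
rewrite -[m.+1.+1]/(m.+2) e; lia.
Qed.

Definition primorial n := \prod_(0 <= p < n.+1 | prime p) p.

Lemma primorialS n : primorial n.+1 = (if prime n.+1 then n.+1 else 1) * primorial n.
Proof. by rewrite /primorial big_mkcond big_nat_recr //= -big_mkcond mulnC. Qed.

Lemma prime_prod_dvd N (s : seq nat) :
  uniq s -> all prime s -> all (fun p => p %| N) s -> \prod_(p <- s) p %| N.
Proof.
elim: s => [|p s IH] /=; first by rewrite big_nil dvd1n.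
move=> /andP[pns us] /andP[pp ps] /andP[dp ds]; rewrite big_cons.
rewrite Gauss_dvd ?dp ?IH //.
rewrite big_seq_cond; apply: (big_ind (fun x => coprime p x)) => [|x y|q].
- by rewrite coprimen1.
- by rewrite coprimeMr => -> ->.
rewrite andbT => qs; rewrite prime_coprime //.
by apply: contra pns; rewrite dvdn_prime2 // ?(allP ps) // => /eqP->.
Qed.

(** The coefficients at [k] and [k.+1] in the expansion of [2 ^ (k.*2.+1)] are equal, so each is at
    most half of it. *)
Lemma bin_odd_le k : 'C(k.*2.+1, k) <= 4 ^ k.
Proof.
have h : 2 * 'C(k.*2.+1, k) <= 2 ^ (k.*2.+1).
  rewrite -[2]/(1 + 1) expnDn.
  have -> : \sum_(i < (k.*2.+1).+1) 'C(k.*2.+1, i) * (1 ^ (k.*2.+1 - i) * 1 ^ i)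
     = \sum_(i < (k.*2.+1).+1) 'C(k.*2.+1, i).
    by apply: eq_bigr => i _; rewrite !exp1n !muln1.
  have h1 : k < k.*2.+2 by lia.
  have h2 : k.+1 < k.*2.+2 by lia.
  rewrite (bigD1 (Ordinal h1)) //= (bigD1 (Ordinal h2)) /=; last first.
    by rewrite -val_eqE /=; lia.
  have -> : 'C(k.*2.+1, k.+1) = 'C(k.*2.+1, k).
    by rewrite -[RHS]bin_sub; [congr 'C(_, _); lia | lia].
  by rewrite addnA; lia.
by move: h; rewrite expnS leq_pmul2l // -mul2n expnM.
Qed.

(** [p] divides (2k+1)! but neither k! nor (k+1)!, whose factors are all smaller than [p]. *)
Lemma dvdn_bin_prime k p : prime p -> k.+1 < p -> p <= k.*2.+1 -> p %| 'C(k.*2.+1, k).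
Proof.
move=> pp kp pk.
have : p %| (k.*2.+1)`! by rewrite dvdn_fact ?prime_gt0.
rewrite -(@bin_fact (k.*2.+1) k); last by lia.
have nf j : j < p -> ~~ (p %| j`!).
  elim: j => [|j IH] jp; first by rewrite Euclid_dvd1.
  rewrite factS Euclid_dvdM // negb_or IH ?andbT; last by lia.
  by rewrite gtnNdvd.
rewrite !Euclid_dvdM // (negPf (nf k _)); last by lia.
by rewrite (negPf (nf (k.*2.+1 - k) _)) ?orbF //; lia.
Qed.

(** Strong induction. An even number above 2 is not prime; for 2k+1, the primes up to k+1 are
    bounded by induction, and the larger ones divide ['C(k.*2.+1, k)], which is at most [4 ^ k]. *)
Lemma primorial_le n : primorial n <= 4 ^ n.
Proof.
elim/ltn_ind: n => -[|[|[|n]]] IH; try by rewrite /primorial unlock.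
case: (boolP (odd n)) => on.
  have np : ~~ prime n.+3.
    apply/negP => pn; have [|] := even_prime pn; first by lia.
    by rewrite /= on.
  rewrite primorialS (negPf np) mul1n (leq_trans (IH _ _)) // leq_exp2l //.
have [k ek] : exists k, n.+3 = k.*2.+1 by exists (n.+2./2); lia.
rewrite ek.
rewrite /primorial (@big_cat_nat _ _ _ k.+2) //=; last by lia.
have -> : 4 ^ k.*2.+1 = 4 ^ k.+1 * 4 ^ k by rewrite -expnD; congr (_ ^ _); lia.
apply: leq_mul; first by apply: IH; lia.
apply: leq_trans (bin_odd_le k); apply: dvdn_leq; first by rewrite bin_gt0; lia.
rewrite -big_filter; apply: prime_prod_dvd; first by rewrite filter_uniq ?iota_uniq.
  by apply/allP => p; rewrite mem_filter => /andP[].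
apply/allP => p; rewrite mem_filter mem_index_iota => /andP[pp /andP[h1 h2]].
by apply: dvdn_bin_prime.
Qed.

(** Legendre's formula for (2m)! = C(2m, m) m! m!, with both sums taken up to 2m so that they can be
    compared term by term. *)
Lemma logn_central_bin m p : prime p ->
  \sum_(1 <= k < m.*2.+1) m.*2 %/ p ^ k =
    logn p 'C(m.*2, m) + \sum_(1 <= k < m.*2.+1) 2 * (m %/ p ^ k).
Proof.
move=> pp; rewrite -logn_fact //.
rewrite -(@bin_fact m.*2 m) ?lognM ?bin_gt0 ?muln_gt0 ?fact_gt0 //; try by lia.
have -> : m.*2 - m = m by lia.
congr (_ + _); rewrite -big_distrr /=.
rewrite (@big_cat_nat _ _ _ m.+1) //=; last by lia.
rewrite -logn_fact // [X in _ = 2 * (_ + X)]big1_seq; first by lia.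
move=> k /=; rewrite mem_index_iota => /andP[mk _]; apply: divn_small.
by apply: leq_trans (ltn_expl k (prime_gt1 pp)); lia.
Qed.

(** In Legendre's sums each exponent [k] adds at most 1 to the valuation, and nothing once [p ^ k]
    exceeds [m.*2]. *)
Lemma logn_central_bin_le m p : prime p -> 0 < m -> p ^ logn p 'C(m.*2, m) <= m.*2.
Proof.
move=> pp m0; set t := trunc_log p m.*2.
have p1 := prime_gt1 pp.
suff vt : logn p 'C(m.*2, m) <= t.
  apply: leq_trans (trunc_logP p1 (_ : 0 < m.*2)); last by lia.
  by rewrite leq_exp2l.
have := logn_central_bin m pp.
have : \sum_(1 <= k < m.*2.+1) m.*2 %/ p ^ k <=
   \sum_(1 <= k < m.*2.+1) ((k <= t) + 2 * (m %/ p ^ k)).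
  apply: leq_sum => k _; case: (leqP k t) => kt /=.
    have := divn_eq m (p ^ k); have := ltn_pmod m (_ : 0 < p ^ k).
    rewrite expn_gt0 prime_gt0 // => /(_ isT) hm em.
    rewrite -ltnS ltn_divLR ?expn_gt0 ?prime_gt0 //; nia.
  by rewrite divn_small // (leq_trans (trunc_log_ltn m.*2 p1)) // leq_exp2l.
have tb : \sum_(1 <= k < m.*2.+1) (k <= t) <= t.
  have {2}-> : t = \sum_(1 <= k < t.+1) 1 by rewrite sum_nat_const_nat; lia.
  have tm : t <= m.*2.
    apply: leq_trans (trunc_logP p1 (_ : 0 < m.*2)); last by lia.
    exact: ltnW (ltn_expl _ _).
  rewrite [X in X <= _](@big_cat_nat _ _ _ t.+1) //=.
  rewrite [X in _ + X]big1_seq ?addn0; last first.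
    by move=> k /=; rewrite mem_index_iota => /andP[h _]; rewrite leqNgt h.
  by apply: leq_sum => k _; apply: leq_b1.
rewrite big_split /=; lia.
Qed.

(** At exponent 1 both sides of Legendre's formula contribute 2; the higher powers of [p] exceed 2m
    because [p] is at least 3. *)
Lemma logn_central_bin_eq0 m p :
  prime p -> 2 < p -> m.*2 < 3 * p -> p <= m -> logn p 'C(m.*2, m) = 0.
Proof.
move=> pp p2 mp pm; have := logn_central_bin m pp.
have : \sum_(1 <= k < m.*2.+1) m.*2 %/ p ^ k <=
   \sum_(1 <= k < m.*2.+1) 2 * (m %/ p ^ k).
  rewrite big_seq [X in _ <= X]big_seq.
  apply: leq_sum => -[|[|k]]; rewrite mem_index_iota // => _.
    rewrite expn1; have -> : m %/ p = 1 by nia.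
    by rewrite muln1 -ltnS ltn_divLR; lia.
  rewrite divn_small //; apply: (@leq_trans (p ^ 2)); first by rewrite expnS expn1; nia.
  by rewrite leq_exp2l // ltnW.
lia.
Qed.

(** The three factors bound the contributions of the primes up to [s], of those between [s] and
    2m/3, which occur at most once, and of the possible prime 2m - 1, which [hp] does not
    exclude. *)
Lemma central_bin_le m s : 2 < m -> m.*2 < s.+1 * s.+1 ->
  (forall p, prime p -> m < p -> p < m.*2 - 2 -> False) ->
  'C(m.*2, m) <= m.*2 ^ s * primorial (m.*2 %/ 3) * m.*2.
Proof.
move=> m2 ms hp; set C := 'C(_, _).
have C0 : 0 < C by rewrite bin_gt0; lia.
rewrite -[C in X in X <= _](partnT C0) (@widen_partn (C + m.*2)) ?leq_addr //.
rewrite (@big_cat_nat _ _ _ m.*2.+1) //=; last by lia.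
rewrite [X in _ * X]big1_seq ?muln1; last first.
  move=> p; rewrite mem_index_iota => /andP[_ /andP[mp _]].
  case: (boolP (prime p)) => pp; last by rewrite lognE (negPf pp).
  have := logn_central_bin_le pp (_ : 0 < m); rewrite -/C.
  case: (logn p C) => [//|v] /(_ ltac:(lia)); rewrite expnS => h.
  have : 0 < p ^ v by rewrite expn_gt0 prime_gt0.
  by move: (p ^ v) h => x; nia.
apply: (@leq_trans (\prod_(0 <= p < m.*2.+1)
   ((if 0 < p <= s then m.*2 else 1) *
    (if prime p && (p <= m.*2 %/ 3) then p else 1) *
    (if p == m.*2.-1 then m.*2 else 1)))).
  apply: leq_prod => p _.
  case: (boolP (prime p)) => pp /=; last first.
    rewrite lognE (negPf pp) /= expn0 !muln_gt0; do ?(case: ifP => _); lia.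
  have vle := logn_central_bin_le pp (_ : 0 < m).
  rewrite -/C in vle; have {}vle := vle ltac:(lia).
  rewrite prime_gt0 //=.
  case: (leqP p s) => ps /=.
    have [p0 N0] : 0 < p /\ 0 < m.*2 by split; [exact: prime_gt0 | lia].
    by apply: (leq_trans vle); do ?(case: ifP => _); nia.
  have v1 : logn p C <= 1.
    rewrite leqNgt; apply/negP => v2.
    have : p ^ 2 <= p ^ logn p C by rewrite leq_exp2l // prime_gt1.
    by rewrite expnS expn1; nia.
  case: (leqP p (m.*2 %/ 3)) => p3 /=.
    rewrite mul1n; apply: (@leq_trans (p ^ 1)); first by rewrite leq_exp2l ?prime_gt1.
    by have p0 := prime_gt0 pp; rewrite expn1; case: ifP => _; nia.
  rewrite !mul1n; case: eqP => [//|pm].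
  suff -> : logn p C = 0 by [].
  have p2 := prime_gt1 pp.
  case: (leqP p m) => mp.
    by apply: logn_central_bin_eq0 => //; move: p3 ms; nia.
  have hm : m.*2 < p.
    rewrite ltnNge; apply/negP => pm2; apply: (hp p) => //.
    have np : p <> m.*2 by move=> e; have [|] := even_prime pp; lia.
    have np2 : p <> m.*2 - 2 by move=> e; have [|] := even_prime pp; lia.
    by lia.
  case: (logn p C) vle => [//|v]; rewrite expnS => h.
  have : 0 < p ^ v by rewrite expn_gt0 prime_gt0.
  by move: (p ^ v) h => x; nia.
rewrite !big_split /= !leq_mul //.
- rewrite -big_mkcond /=.
  apply: (@leq_trans (\prod_(1 <= p < s.+1) m.*2)); last first.
    by rewrite prod_nat_const_nat subn1.
  case: (leqP s m.*2) => sm.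
    rewrite (@big_cat_nat _ _ _ s.+1) //= [X in _ * X]big1_seq ?muln1; last first.
      by move=> p /andP[/andP[_ ps]]; rewrite mem_index_iota; lia.
    rewrite big_ltn_cond //= big_nat_cond [X in _ <= X]big_nat_cond.
    by rewrite (eq_bigl (fun p => (0 < p < s.+1) && true)) // => p; lia.
  rewrite prod_nat_const_nat.
  apply: (@leq_trans (\prod_(1 <= p < m.*2.+1) m.*2)).
    rewrite big_ltn_cond //= big_nat_cond [X in _ <= X]big_nat_cond.
    by rewrite (eq_bigl (fun p => (0 < p < m.*2.+1) && true)) // => p; lia.
  by rewrite prod_nat_const_nat leq_exp2l; lia.
- rewrite -big_mkcond /= /primorial (@big_cat_nat _ _ _ (m.*2 %/ 3).+1) //=; last first.
    by rewrite ltnS leq_div.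
  rewrite [X in _ * X]big1_seq ?muln1; last first.
    by move=> p /andP[/andP[_ ps]]; rewrite mem_index_iota; lia.
  rewrite big_nat_cond [X in _ <= X]big_nat_cond leq_eqVlt; apply/orP; left.
  by apply/eqP; apply: eq_bigl => p; rewrite ltnS; case: (prime p); rewrite ?andbF //=; lia.
- rewrite -big_mkcond /= big_nat1_eq; case: ifP => _ //.
  by rewrite double_gt0 (leq_trans _ m2).
Qed.

Lemma expn_gap s : 38 <= s -> (s.+1 * s.+1) ^ (3 * s.+2) < 2 ^ (s * s).
Proof.
(* Chosen so that 6j(s+2) <= (s-2)(s+2) < [s * s], while [s.+1 <= 2 ^ j]: the bound [38 <= s] gives
   [6 <= j], from where on 6j + 8 <= [2 ^ j]. *)
move=> s38; set j := (s - 2) %/ 6.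
have j6 : 6 <= j by rewrite /j; lia.
have js : s.+1 <= 6 * j + 8 by rewrite /j; lia.
have sj : s.+1 <= 2 ^ j.
  apply: leq_trans js _.
  elim: j j6 => // j IH; rewrite leq_eqVlt => /predU1P[<- //|]; rewrite ltnS => j6.
  by have := IH j6; rewrite expnS; move: (2 ^ j) => x; lia.
rewrite -[s.+1 * s.+1]/(s.+1 ^ 2) -expnM.
apply: (@leq_ltn_trans (2 ^ (j * (2 * (3 * s.+2))))).
  by rewrite [X in _ <= X]expnM leq_exp2r //; lia.
have jj : 6 * j <= s - 2 by rewrite /j; lia.
rewrite ltn_exp2l //; nia.
Qed.

Lemma bertrand_big m : 722 <= m -> exists p, [/\ prime p, m < p & p < m.*2 - 2].
Proof.
move=> m722; case: (boolP (has (fun p => prime p && (m < p < m.*2 - 2)) (iota 0 m.*2))).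
  by case/hasP=> p _ /and3P[*]; exists p.
move=> /hasPn np; exfalso.
have [s s1 s2] : exists2 s, s * s <= m.*2 & m.*2 < s.+1 * s.+1.
  have := @ex_maxnP (fun s => s * s <= m.*2) m.*2 (ex_intro _ 0 isT).
  case=> [i|s h1 h2]; first by nia.
  by exists s => //; rewrite ltnNge; apply/negP => /h2; rewrite ltnn.
(* 722 is half of 38 * 38, and 38 is the threshold of [expn_gap]. *)
have s38 : 38 <= s by nia.
have hp p : prime p -> m < p -> p < m.*2 - 2 -> False.
  move=> pp h1 h2.
  have pm : p \in iota 0 m.*2 by rewrite mem_iota /= add0n (leq_trans h2) // leq_subr.
  by have := np p pm; rewrite pp h1 h2.
have m2 : 2 < m by apply: leq_trans m722.
have cb := central_bin_le m2 s2 hp.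
have cg := central_bin_ge (ltnW (ltnW m2)).
have pl := primorial_le (m.*2 %/ 3).
set N := m.*2 in s1 s2 cb cg pl.
have h : 2 ^ N <= N ^ s.+2 * 4 ^ (N %/ 3).
  have -> : 2 ^ N = 4 ^ m by rewrite /N -mul2n expnM.
  rewrite !expnS; move: cb cg pl; move: (4 ^ m) ('C(_, _)) (primorial _) (4 ^ _) (N ^ s).
  move=> a b c d e h1 h2 h3.
  apply: (leq_trans h2); rewrite -mulnA leq_mul2l; apply/orP; right.
  apply: (leq_trans h1); rewrite mulnC -mulnA leq_mul2l; apply/orP; right.
  by rewrite leq_mul2l h3 orbT.
(* Cubing removes the division by 3; the resulting power of 4 is at most [2 ^ N * 2 ^ N] and cancels
   two of the three factors [2 ^ N]. *)
have h3 : 2 ^ N <= N ^ (3 * s.+2).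
  have : (2 ^ N) ^ 3 <= (N ^ s.+2 * 4 ^ (N %/ 3)) ^ 3 by rewrite leq_exp2r.
  rewrite expnMn -!expnM => h3.
  have h4 : 4 ^ (N %/ 3 * 3) <= 2 ^ N * 2 ^ N.
    rewrite -expnD -[4]/(2 ^ 2) -expnM leq_exp2l //; lia.
  have e3 : 2 ^ (N * 3) = 2 ^ N * (2 ^ N * 2 ^ N) by rewrite -!expnD; congr (_ ^ _); lia.
  have x0 : 0 < 2 ^ N by rewrite expn_gt0.
  rewrite e3 mulnC [3 * _]mulnC in h3 *.
  rewrite -(@leq_pmul2l (2 ^ N * 2 ^ N)) ?muln_gt0 ?x0 //.
  by apply: (leq_trans h3); rewrite mulnC leq_mul2r h4 orbT.
have := expn_gap s38; rewrite ltnNge => /negP; apply.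
apply: (@leq_trans (2 ^ N)); first by rewrite leq_exp2l.
by apply: (leq_trans h3); rewrite leq_exp2r // ltnW.
Qed.

Lemma bertrand_postulate m : 4 <= m -> exists p, [/\ prime p, m < p & p < m.*2 - 2].
Proof.
move=> m4; case: (leqP 722 m) => [/bertrand_big //|m7].
(* Each prime listed after 5 is less than twice its predecessor minus 2, so it serves every [m] from
   that predecessor to just below itself. *)
case: (ltnP m 5) => m5; first by exists 5; split => //; lia.
case: (ltnP m 7) => m6; first by exists 7; split => //; lia.
case: (ltnP m 11) => m11; first by exists 11; split => //; lia.
case: (ltnP m 13) => m13; first by exists 13; split => //; lia.
case: (ltnP m 23) => m23; first by exists 23; split => //; lia.
case: (ltnP m 43) => m43; first by exists 43; split => //; lia.
case: (ltnP m 83) => m83; first by exists 83; split => //; lia.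
case: (ltnP m 163) => m163; first by exists 163; split => //; lia.
case: (ltnP m 317) => m317; first by exists 317; split => //; lia.
case: (ltnP m 631) => m631; first by exists 631; split => //; lia.
by exists 1259; split => //; lia.
Qed.

(** The bound [m.*2 - 2] in Bertrand's postulate is what leaves three points outside a [p]-cycle, as
    the construction of a 3-cycle requires. *)
Lemma bertrand_gap n : 8 <= n -> exists p, [/\ prime p, n < 2 * p & p + 3 <= n].
Proof.
move=> n8; have n4 : 4 <= n./2 by lia.
have [p [pp p1 p2]] := bertrand_postulate n4.
by exists p; split => //; lia.
Qed.

(** * Transitivity on sets of a given size *)

Section SetSums.
Import GRing.Theory Num.Theory.
Local Open Scope ring_scope.

Lemma card_interval_draws (T : finType) (W B : {set T}) (z : nat) : [disjoint W & B] ->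
  #|[set L : {set T} | (#|L| == #|W| + z)%N & (W \subset L) && (L \subset W :|: B)]|
    = 'C(#|B|, z).
Proof.
move=> dWB; rewrite -cards_draws.
have dZ (Z : {set T}) : Z \subset B -> [disjoint W & Z].
  by move=> ZB; apply: disjointWr ZB dWB.
have injU : {in [set A : {set T} | A \subset B & #|A| == z] &, injective (fun Z => W :|: Z)}.
  move=> Z1 Z2; rewrite !inE => /andP[s1 _] /andP[s2 _] e.
  have K (Z : {set T}) : Z \subset B -> (W :|: Z) :\: W = Z.
    by move=> /dZ dd; rewrite setDUl setDv set0U; apply/setDidPl; rewrite disjoint_sym.
  by rewrite -(K _ s1) -(K _ s2) e.
rewrite -(card_in_imset injU); apply: eq_card => L; rewrite inE.
apply/idP/imsetP => [/and3P[/eqP cL sWL sLB]|[Z]].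
  exists (L :\: W); last by rewrite -{1}(setID L W) (setIidPr sWL).
  rewrite inE cardsD (setIidPr sWL) cL addKn eqxx andbT.
  by rewrite subDset.
rewrite inE => /andP[ZB /eqP cZ] ->.
by rewrite subsetUl setUS // cardsU cZ (disjoint_setI0 (dZ _ ZB)) cards0 subn0 eqxx.
Qed.

(* Split the sum over the [l]-sets meeting [K0] in [I] according to [K :&: K0]: the induction on
   [I] makes the system triangular. *)
Lemma subset_sums_eq0 (T : finType) (k l : nat) (f : {set T} -> int) :
  (k <= l)%N -> (k + l <= #|T|)%N ->
  (forall L : {set T}, #|L| = l -> \sum_(K : {set T} | (K \subset L) && (#|K| == k)) f K = 0) ->
  forall K0 : {set T}, #|K0| = k -> f K0 = 0.
Proof.
move=> kl kln f0 K0 cK0.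
(* For [I = K0] the only summand is [f K0]. *)
pose M (I : {set T}) := \sum_(K : {set T} | (#|K| == k) && (K :&: K0 == I)) f K.
suff MI i (I : {set T}) : #|I| = i -> I \subset K0 -> M I = 0.
  rewrite -[RHS](MI k K0) //.
  rewrite /M (bigD1 K0) /=; last by rewrite cK0 setIid !eqxx.
  rewrite big1 ?addr0 // => K /andP[/andP[/eqP cK /eqP KK0] nK].
  case/eqP: nK; apply/esym/eqP; rewrite eqEcard cK cK0 leqnn andbT.
  by rewrite -KK0 subsetIl.
elim/ltn_ind: i I => i IH I cI sI.
have ik : (i <= k)%N by rewrite -cI -cK0 subset_leq_card.
have : \sum_(L : {set T} | (#|L| == l) && (L :&: K0 == I))
   \sum_(K : {set T} | (K \subset L) && (#|K| == k)) f K = 0.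
  by apply: big1 => L /andP[/eqP /f0].
rewrite (exchange_big_dep (fun K : {set T} => #|K| == k)) /=; last by move=> ? ? _ /andP[].
(* The number of [l]-sets that meet [K0] exactly in [I] and contain a given [K] with [K :&: K0] a
   [j]-subset of [I]: they contain [I] and [K :\: K0], and their other points avoid [K0 :|: K]. The
   test guards the truncated subtraction. *)
pose c j := (if i + (k - j) <= l then 'C(#|T| - (k + k - j), l - (i + (k - j))) else 0)%N.
have cnt (K : {set T}) : #|K| = k -> K :&: K0 \subset I ->
   #|[set L : {set T} | ((#|L| == l) && (L :&: K0 == I)) && (K \subset L)]| =
     c #|K :&: K0|.
  move=> cK sJ; set J := K :&: K0.
  have ji : (#|J| <= i)%N by rewrite -cI subset_leq_card.
  have cU : #|K0 :|: K| = (k + k - #|J|)%N by rewrite cardsU cK0 cK setIC.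
  have cKK0 : #|K :\: K0| = (k - #|J|)%N by rewrite cardsD cK.
  have dI : [disjoint I & K :\: K0].
    rewrite -setI_eq0; apply/eqP/setP => x; rewrite !inE.
    by case: (boolP (x \in I)) => // /(subsetP sI) ->.
  have cW : #|I :|: K :\: K0| = (i + (k - #|J|))%N.
    by rewrite cardsU (disjoint_setI0 dI) cards0 subn0 cI cKK0.
  rewrite /c; case: (leqP (i + (k - #|J|)) l) => il; last first.
    apply: eq_card0 => L; rewrite !inE; apply/negP => /andP[/andP[/eqP cL /eqP LI] KL].
    have : I :|: K :\: K0 \subset L.
      by rewrite subUset (subset_trans (subsetDl _ _) KL) -LI subsetIl.
    by move/subset_leq_card; rewrite cW cL leqNgt il.
  have := @card_interval_draws T (I :|: (K :\: K0)) (~: (K0 :|: K)) (l - (i + (k - #|J|))).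
  rewrite [#|~: _|]cardsCs setCK cU => <-; last first.
    rewrite -setI_eq0; apply/eqP/setP => x; rewrite !inE.
    case: (boolP (x \in I)) => [/(subsetP sI) -> //|_] /=.
    by case: (x \in K0) => //=; case: (x \in K).
  apply: eq_card => L; rewrite !inE cW subnKC // -andbA; congr (_ && _).
  apply/andP/andP => [[/eqP LI KL]|[WL LW]].
    split; first by rewrite subUset (subset_trans (subsetDl _ _) KL) -LI subsetIl.
    apply/subsetP => x xL; rewrite !inE -LI !inE xL /=.
    by case: (x \in K0) => //=; case: (x \in K).
  split.
    rewrite eqEsubset; apply/andP; split; last first.
      by rewrite subsetI sI andbT; move: WL; rewrite subUset => /andP[].
    apply/subsetP => x; rewrite !inE => /andP[xL xK0].
    by have := subsetP LW x xL; rewrite !inE xK0 /= !orbF.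
  apply/subsetP => x xK; case: (boolP (x \in K0)) => xK0.
    by apply: (subsetP WL); rewrite inE (subsetP sJ) // inE xK.
  by apply: (subsetP WL); rewrite !inE xK xK0 orbT.
rewrite (partition_big (fun K => K :&: K0) (fun J => J \subset K0)) /=; last first.
  by move=> K _; apply: subsetIr.
(* The coefficient of [M I] is nonzero by [k + l <= #|T|]. Proper subsets [J] of [I] vanish by
   induction; any other [J] contributes nothing, since [K \subset L] forces [K :&: K0] into [I]. *)
rewrite (bigD1 I) //= [X in _ + X]big1 => [|J /andP[sJ nJ]].
  rewrite addr0.
  rewrite (eq_bigr (fun K => f K *+ c i)); last first.
    move=> K /andP[/eqP cK /eqP KI].
    rewrite (eq_bigl (mem [set L : {set T} | ((#|L| == l) && (L :&: K0 == I)) && (K \subset L)])).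
      by rewrite sumr_const cnt ?KI ?cI.
    by move=> L; rewrite !inE cK eqxx andbT.
  rewrite sumrMnl => /eqP; rewrite mulrn_eq0 => /orP[|/eqP //].
  by rewrite /c subnKC // kl -leqn0 leqNgt bin_gt0; lia.
case: (boolP (J \subset I)) => sJI.
  have JI : (#|J| < i)%N.
    by rewrite -cI; apply: proper_card; rewrite properEneq nJ.
  rewrite (eq_bigr (fun K => f K *+ c #|J|)); last first.
    move=> K /andP[/eqP cK /eqP KJ].
    rewrite (eq_bigl (mem [set L : {set T} | ((#|L| == l) && (L :&: K0 == I)) && (K \subset L)])).
      by rewrite sumr_const cnt ?KJ.
    by move=> L; rewrite !inE cK eqxx andbT.
  by rewrite sumrMnl -/(M J) (IH _ JI) ?mul0rn.
apply: big1 => K /andP[_ /eqP KJ]; apply: big_pred0 => L.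
apply/negP => /andP[/andP[_ /eqP LI] /andP[KL _]].
by case/negP: sJI; rewrite -KJ -LI setSI.
Qed.
End SetSums.

Definition homogeneous (T : finType) (G : {group {perm T}}) (k : nat) : Prop :=
  forall S R : {set T}, #|S| = k -> #|R| = k -> exists2 g, g \in G & [set g x | x in S] = R.

Lemma imset_perm1 (T : finType) (S : {set T}) : [set (1%g : {perm T}) x | x in S] = S.
Proof. by rewrite -[RHS]imset_id; apply: eq_imset => x; rewrite perm1. Qed.

Lemma imset_permM (T : finType) (g h : {perm T}) (S : {set T}) :
  [set (g * h)%g x | x in S] = [set h x | x in [set g x | x in S]].
Proof. by rewrite -imset_comp; apply: eq_imset => x /=; rewrite permM. Qed.

Definition set_orbit (T : finType) (G : {group {perm T}}) (S K : {set T}) : bool :=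
  [exists g in G, [set (g : {perm T}) x | x in S] == K].

Lemma set_orbit_refl (T : finType) (G : {group {perm T}}) (S : {set T}) : set_orbit G S S.
Proof. by apply/exists_inP; exists 1%g; rewrite ?group1 // imset_perm1. Qed.

Lemma set_orbit_imset (T : finType) (G : {group {perm T}}) (S K : {set T}) (g : {perm T}) :
  g \in G -> set_orbit G S [set g x | x in K] = set_orbit G S K.
Proof.
move=> gG; apply/exists_inP/exists_inP => -[h hG /eqP e].
  exists (h * g^-1)%g; first by rewrite groupM ?groupV.
  by rewrite imset_permM e -imset_permM mulgV imset_perm1.
by exists (h * g)%g; rewrite ?groupM // imset_permM e.
Qed.

Lemma imset_permD (T : finType) (g : {perm T}) (S R : {set T}) :
  [set g x | x in S :\: R] = [set g x | x in S] :\: [set g x | x in R].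
Proof.
apply/setP => x; rewrite -[x](permKV g) inE !(mem_imset _ _ (@perm_inj _ g)).
by rewrite inE.
Qed.

(** The number [b L] of [k]-subsets of [L] in the orbit of [S] is the same for all [l]-sets [L].
    Hence ['C(l, k)] times the indicator of the orbit, minus this constant, sums to 0 over the
    [k]-subsets of each [l]-set, and vanishes by [subset_sums_eq0]. So the indicator is constant. *)
Lemma Livingstone_Wagner (T : finType) (G : {group {perm T}}) k l :
  homogeneous G l -> k <= l -> k + l <= #|T| -> homogeneous G k.
Proof.
move=> hl kl kln S R cS cR.
set O := set_orbit G S.
pose b (L : {set T}) := #|[set K : {set T} | (K \subset L) && (#|K| == k) & O K]|.
have bE (L1 L2 : {set T}) : #|L1| = l -> #|L2| = l -> b L1 <= b L2.
  move=> c1 c2; have [g gG e] := hl L1 L2 c1 c2.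
  have inj : injective (fun K : {set T} => [set g x | x in K]).
    by apply: imset_inj; apply: perm_inj.
  rewrite /b -(card_imset _ inj); apply: subset_leq_card; apply/subsetP => K'.
  case/imsetP => K; rewrite inE => /andP[/andP[KL cK] OK] ->.
  rewrite inE /O set_orbit_imset // -/O OK andbT.
  by rewrite card_imset ?cK ?andbT; [rewrite -e imsetS | apply: perm_inj].
case: (boolP (O R)) => [/exists_inP[g gG /eqP <-]|nOR]; first by exists g.
exfalso.
have [L0 cL0] : exists L : {set T}, #|L| = l.
  have : 0 < #|[set A : {set T} | #|A| == l]|.
    by rewrite card_draws bin_gt0; apply: leq_trans kln; rewrite leq_addl.
  by case/card_gt0P => L; rewrite inE => /eqP cL; exists L.
pose f (K : {set T}) := ((if O K then 'C(l, k)%:Z else 0) - (b L0)%:Z)%R.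
have f0 := @subset_sums_eq0 T k l f kl kln.
have {}f0 : forall K : {set T}, #|K| = k -> f K = 0%R.
  apply: f0 => L cL.
  have cd : #|[set K : {set T} | (K \subset L) & (#|K| == k)]| = 'C(l, k).
    by rewrite cards_draws cL.
  rewrite (eq_bigl (mem [set K : {set T} | (K \subset L) & (#|K| == k)])); last first.
    by move=> K; rewrite !inE.
  rewrite /f GRing.sumrB GRing.sumr_const cd -big_mkcondr /=.
  rewrite (eq_bigl (mem [set K : {set T} | (K \subset L) && (#|K| == k) & O K])); last first.
    by move=> K; rewrite !inE.
  rewrite GRing.sumr_const -/(b L).
  have -> : b L = b L0 by apply/eqP; rewrite eqn_leq !bE.
  lia.
have hR := f0 R cR; have hS := f0 S cS.
move: hR hS; rewrite /f (negPf nOR) /O set_orbit_refl.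
have : 0 < 'C(l, k) by rewrite bin_gt0.
lia.
Qed.

Lemma homogeneousC (T : finType) (G : {group {perm T}}) k :
  k <= #|T| -> homogeneous G k -> homogeneous G (#|T| - k).
Proof.
move=> kT hk S R cS cR.
have [||g gG e] := hk (~: S) (~: R); try by rewrite cardsCs setCK ?cS ?cR subKn.
exists g => //; apply: setC_inj; rewrite -e.
apply/setP => x; rewrite inE -[x](permKV g) !(mem_imset _ _ (@perm_inj _ g)).
by rewrite inE.
Qed.

(** Sizes up to [h] follow from Livingstone-Wagner, larger ones by passing to complements first. *)
Lemma homogeneous_half (T : finType) (G : {group {perm T}}) h k :
  homogeneous G h -> #|T| <= h.*2.+1 -> h.*2 <= #|T| -> k <= #|T| -> homogeneous G k.
Proof.
move=> hh h1 h2 kT; case: (leqP k h) => kh.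
  by apply: (Livingstone_Wagner hh) => //; lia.
rewrite -(subKn kT); apply: homogeneousC; first exact: leq_subr.
by apply: (Livingstone_Wagner hh); lia.
Qed.

Lemma homogeneous_exchange (T : finType) (G : {group {perm T}}) k :
  (forall (S : {set T}) x y, #|S| = k -> x \in S -> y \notin S ->
     exists2 g, g \in G & [set (g : {perm T}) z | z in S] = y |: S :\ x) ->
  homogeneous G k.
Proof.
move=> ex S R; move e: #|R :\: S| => m; elim: m S e => [|m IH] S e cS cR.
  exists 1%g; rewrite ?group1 // imset_perm1; apply/eqP; rewrite eq_sym eqEcard cS cR leqnn andbT.
  by rewrite -setD_eq0 -cards_eq0 e.
have /card_gt0P[y] : 0 < #|R :\: S| by rewrite e.
rewrite inE => /andP[yS yR].
have cSR : #|S :\: R| = #|R :\: S| by rewrite !cardsD cS cR setIC.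
have /card_gt0P[x] : 0 < #|S :\: R| by rewrite cSR e.
rewrite inE => /andP[xR xS].
have [g gG gS] := ex S x y cS xS yS.
have cS' : #|y |: S :\ x| = k.
  have := cardsD1 x S; rewrite xS cS => ->.
  by rewrite cardsU1 !inE (negPf yS) andbF.
have [|h hG hS] := IH (y |: S :\ x) _ cS' cR.
  have -> : R :\: (y |: S :\ x) = (R :\: S) :\ y.
    apply/setP => z; rewrite !inE; case: (z =P y) => //= _.
    by case: (z =P x) => [->|] //=; rewrite (negPf xR) !andbF.
  by have := cardsD1 y (R :\: S); rewrite inE yS yR e => -[].
by exists (g * h)%g; rewrite ?groupM // imset_permM gS.
Qed.

(** * Transitive groups containing a p-cycle with p > n / 2 *)

Section Jordan.
Local Open Scope group_scope.

Lemma prime_cycle_gen (gT : finGroupType) (s : gT) p k :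
  prime p -> #[s] = p -> s ^+ k != 1 -> s \in <[s ^+ k]>.
Proof.
move=> pp os sk; suff -> : <[s ^+ k]> = <[s]> by apply: cycle_id.
apply/eqP; rewrite eq_sym -/(generator _ _) generator_coprime os prime_coprime //.
by apply: contra sk => /dvdnP[q ->]; rewrite mulnC expgM -os expg_order expg1n.
Qed.

Variables (T : finType) (G : {group {perm T}}).

(** The witness moves points of [D] only, so this is transitivity on tuples for the pointwise
    stabiliser of the complement of [D]. *)
Definition seq_trans_on (D : {set T}) (i : nat) := forall s t : seq T,
  uniq s -> uniq t -> size s = size t -> size s <= i ->
  {subset s <= D} -> {subset t <= D} ->
  exists h : {perm T}, [/\ h \in G, perm_on D h & map h s = t].

(** Such a [B] is not a block of the same stabiliser: its translate under [h] meets [B] and also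
    leaves it. *)
Definition primitive_on (D : {set T}) := forall B : {set T}, B \subset D -> 1 < #|B| < #|D| ->
  exists h : {perm T}, [/\ h \in G, perm_on D h,
    exists2 u, u \in B & h u \in B & exists2 v, v \in B & h v \notin B].

Definition trans_on (D : {set T}) := forall x y, x \in D -> y \in D ->
  exists h : {perm T}, [/\ h \in G, perm_on D h & h x = y].

Lemma seq_trans_onW D i : 0 < i -> seq_trans_on D i -> trans_on D.
Proof.
move=> i0 sD x y xD yD.
have [| | | | | |h [hG hD [e]]] // := sD [:: x] [:: y].
- by move=> z; rewrite inE => /eqP->.
- by move=> z; rewrite inE => /eqP->.
by exists h.
Qed.

Lemma trans_on_seq D : trans_on D -> seq_trans_on D 1.
Proof.
move=> tD [|x [|? ?]] [|y [|? ?]] //= _ _ _ _ sD tD'.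
  by exists 1; rewrite group1 perm_on1.
have [h [hG hD hx]] := tD x y (sD x (mem_head _ _)) (tD' y (mem_head _ _)).
by exists h; rewrite hx.
Qed.

Lemma seq_trans_primitive D i : 1 < i -> seq_trans_on D i -> primitive_on D.
Proof.
move=> i1 sD B BD /andP[/card_gt1P[x [y [xB yB xy]]] BD'].
have /card_gt0P[z] : 0 < #|D :\: B| by rewrite cardsD (setIidPr BD); lia.
rewrite inE => /andP[zB zD].
have xz : x != z by apply: contraNneq zB => <-.
have [| | | | | |h [hG hD [hx hy]]] // := sD [:: x; y] [:: x; z].
- by rewrite /= inE xy.
- by rewrite /= inE xz.
- by move=> w; rewrite !inE => /orP[] /eqP->; rewrite (subsetP BD).
- by move=> w; rewrite !inE => /orP[] /eqP->; rewrite // (subsetP BD).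
exists h; split=> //; first by exists x; rewrite ?hx.
by exists y; rewrite ?hy.
Qed.

(* Among the translates of [D] take one for which [g @: D :\: D] is minimal and nonempty: by
   primitivity on [D] it is a single point. *)
Lemma primitive_translate D : trans_on setT -> primitive_on D ->
  #|T| < 2 * #|D| -> #|D| < #|T| ->
  exists g : {perm T}, g \in G /\ exists e, [set g x | x in D] :\: D = [set e].
Proof.
move=> tG pD D2 DT.
have [d0 d0D] : exists x, x \in D by apply/card_gt0P; lia.
have [e0 e0D] : exists x, x \in ~: D by apply/card_gt0P; rewrite cardsCs setCK; lia.
have [g0 [g0G _ g0e]] := tG d0 e0 (in_setT _) (in_setT _).
pose w (g : {perm T}) := #|[set g x | x in D] :\: D|.
pose P := [pred g | (g \in G) && (0 < w g)].
have Pg0 : P g0.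
  rewrite /= g0G; apply/card_gt0P; exists e0; rewrite inE -in_setC e0D -g0e.
  by rewrite mem_imset //; apply: perm_inj.
case: (@arg_minnP _ g0 P w Pg0) => g /andP[gG wg] gmin.
have cg (h : {perm T}) : #|[set h x | x in D]| = #|D| by rewrite card_imset //; apply: perm_inj.
exists g; split=> //; apply/cards1P.
rewrite eqn_leq andbC -/(w g) wg leqNgt /=; apply/negP => w2.
set gD := [set g x | x in D].
have cB : #|D :\: gD| = w g by rewrite /w !cardsD cg setIC.
have BD : #|D :\: gD| < #|D|.
  rewrite cardsD.
  have : #|D :|: gD| <= #|T| by apply: max_card.
  rewrite cardsU /gD cg; lia.
(* If [D :\: gD] had two points, it would not be a block. The conjugate [k] of the resulting [h]
   then contradicts minimality: [h u] makes its difference set smaller than that of [g], and [h v]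
   keeps it nonempty. *)
have [||h [hG hD [u uB huB] [v vB hvB]]] := pD (D :\: gD); first exact: subsetDl.
  by rewrite cB w2 -cB BD.
pose k := g * h * g^-1.
have kG : k \in G by rewrite !groupM ?groupV.
have hDD x : (h x \in D) = (x \in D) by rewrite perm_closed.
have wk : w k = #|[set h x | x in gD] :\: gD|.
  rewrite /w -(card_imset _ (@perm_inj _ g)) imset_permD.
  congr #|_ :\: _|.
  by rewrite -imset_permM /k mulgKV imset_permM.
have wk2 : w k = #|gD :\: [set h x | x in gD]|.
  by rewrite wk !cardsD setIC card_imset //; apply: perm_inj.
have sub : gD :\: [set h x | x in gD] \subset [set h x | x in D :\: gD] :\ h u.
  apply/subsetP => y; rewrite !inE => /andP[yh yg].
  have yD : y \in D.
    apply: contraNT yh => yD; rewrite -(out_perm hD yD).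
    by rewrite mem_imset //; apply: perm_inj.
  rewrite -[y](permKV h) (inj_eq (@perm_inj _ h)).
  rewrite mem_imset ?inE; last exact: perm_inj.
  move: yh yD; rewrite -{1 2}[y](permKV h) mem_imset ?hDD; last exact: perm_inj.
  move=> -> -> /=; rewrite andbT; apply: contraTneq yg => e.
  rewrite -[y](permKV h) e.
  by move: huB; rewrite inE => /andP[].
have := gmin k; rewrite /= kG => /(_ _).
have k0 : 0 < w k.
  rewrite wk2; apply/card_gt0P; exists (h v); rewrite inE mem_imset; last exact: perm_inj.
  move: vB hvB; rewrite !inE hDD => /andP[-> ->] /=.
  by rewrite andbT negbK.
move=> /(_ k0); rewrite leqNgt => /negP; apply.
rewrite wk2; apply: leq_ltn_trans (subset_leq_card sub) _.
rewrite -ltnS; have := cardsD1 (h u) [set h x | x in D :\: gD].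
rewrite mem_imset; last exact: perm_inj.
by rewrite uB card_imset ?cB => [->|]; [rewrite ltnS add1n|apply: perm_inj].
Qed.

(** Let [e] be the one point of [g @: D] outside [D]. A point of [D] is moved inside [D] into the
    intersection with the translate, nonempty by [#|T| < 2 * #|D|], and then inside the translate to
    [e]. So [e |: D] is transitive, and the elements supported on [D], which fix [e], raise the
    degree of transitivity by one. *)
Lemma Jordan_step D i : trans_on setT -> 0 < i -> seq_trans_on D i -> primitive_on D ->
  #|T| < 2 * #|D| -> #|D| < #|T| ->
  exists D' : {set T}, [/\ #|D'| = #|D|.+1, seq_trans_on D' i.+1 & primitive_on D'].
Proof.
move=> tG i0 sD pD D2 DT.
have [g [gG [e ge]]] := primitive_translate tG pD D2 DT.
set gD := [set g x | x in D] in ge.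
have : e \in [set e] by rewrite inE.
rewrite -ge inE => /andP[eD egD].
have tD := seq_trans_onW i0 sD.
have cgD : #|gD| = #|D| by rewrite card_imset //; apply: perm_inj.
have gDD' : gD \subset e |: D.
  apply/subsetP => x xg; rewrite !inE; case: (boolP (x \in D)); rewrite ?orbT // => xD.
  have : x \in gD :\: D by rewrite inE xD.
  by rewrite ge inE => ->.
have DD' : D \subset e |: D by apply: subsetUr.
have onD' (S : {set T}) h : S \subset e |: D -> perm_on S h -> perm_on (e |: D) h.
  by move=> sS hS; apply: subset_trans hS sS.
have toe x : x \in e |: D -> exists h : {perm T}, [/\ h \in G, perm_on (e |: D) h & h x = e].
  rewrite !inE => /predU1P[->|xD]; first by exists 1; rewrite group1 perm_on1 perm1.
  have [w] : exists w, w \in D :&: gD.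
    apply/card_gt0P; have : #|D :|: gD| <= #|T| by apply: max_card.
    by rewrite cardsU cgD; lia.
  rewrite inE => /andP[wD wg].
  have [h1 [h1G h1D h1x]] := tD x w xD wD.
  have [/imsetP[a aD ea] /imsetP[b bD eb]] := (wg, egD).
  have [h2 [h2G h2D h2x]] := tD a b aD bD.
  exists (h1 * (h2 ^ g)); split; first by rewrite groupM // groupJ.
    apply: perm_onM; first exact: onD' h1D.
    apply: onD' gDD' _; apply/subsetP => z; rewrite inE; apply: contraR => zg.
    rewrite conjgE !permM (out_perm h2D) ?permKV //.
    apply: contra zg => zz; apply/imsetP; exists (g^-1 z) => //.
    by rewrite permKV.
  by rewrite permM h1x ea conjgE !permM permK h2x eb.
have sD' : seq_trans_on (e |: D) i.+1.
  move=> [|x s] [|y t] //=; first by exists 1; rewrite group1 perm_on1.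
  move=> /andP[xs us] /andP[yt ut] [sst] sz sub1 sub2.
  have [u [uG uD ux]] := toe x (sub1 x (mem_head _ _)).
  have [v [vG vD vy]] := toe y (sub2 y (mem_head _ _)).
  have [| | | | | |h [hG hD hst]] := sD (map u s) (map v t).
  - by rewrite map_inj_uniq //; apply: perm_inj.
  - by rewrite map_inj_uniq //; apply: perm_inj.
  - by rewrite !size_map.
  - by rewrite size_map.
  - move=> z /mapP[a sa ->].
    have : u a \in e |: D by rewrite perm_closed // sub1 // inE sa orbT.
    rewrite !inE => /predU1P[ea|//]; case/negP: xs.
    by move: ea; rewrite -ux => /perm_inj <-.
  - move=> z /mapP[a sa ->].
    have : v a \in e |: D by rewrite perm_closed // sub2 // inE sa orbT.
    rewrite !inE => /predU1P[ea|//]; case/negP: yt.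
    by move: ea; rewrite -vy => /perm_inj <-.
  exists (u * h * v^-1); split; first by rewrite !groupM ?groupV.
    apply: perm_onM; last by apply: perm_onV.
    by apply: perm_onM => //; apply: onD' hD.
  congr (_ :: _); first by rewrite !permM ux (out_perm hD) // -vy permK.
  rewrite -[RHS](mapK (permK v)) -hst -!map_comp; apply: eq_map => z /=.
  by rewrite !permM.
exists (e |: D); split => //; first by rewrite cardsU1 eD.
by apply: seq_trans_primitive sD'.
Qed.

Lemma Jordan_chain D i : trans_on setT -> 0 < i -> seq_trans_on D i -> primitive_on D ->
  #|T| < 2 * #|D| -> seq_trans_on setT (i + (#|T| - #|D|)).
Proof.
move=> tG; move e: (#|T| - #|D|) => m; elim: m D i e => [|m IH] D i e i0 sD pD D2.
  rewrite addn0; suff -> : [set: T] = D by [].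
  by apply/esym/eqP; rewrite eqEcard subsetT cardsT; lia.
have [|D' [cD' sD' pD']] := Jordan_step tG i0 sD pD D2; first lia.
rewrite addnS -addSn; apply: (IH D') => //; rewrite cD'; lia.
Qed.

Lemma seq_trans_homogeneous i k : seq_trans_on setT i -> k <= i -> homogeneous G k.
Proof.
move=> sT ki S R cS cR.
have [| | | | | |h [hG _ e]] := sT (enum S) (enum R);
  rewrite ?enum_uniq -?cardE ?cS ?cR //; try by move=> x _; rewrite in_setT.
exists h => //; apply/setP => x; rewrite -[RHS]mem_enum -e.
by apply/imsetP/mapP => -[y yS ->]; exists y; rewrite // ?mem_enum // -mem_enum.
Qed.

(** The cycles of [s] have length 1 or [p], and there is no room for two of length [p]. *)
Lemma prime_order_orbit (s : {perm T}) p : prime p -> #[s] = p -> #|T| < 2 * p ->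
  exists x, #|porbit s x| = p /\ perm_on (porbit s x) s.
Proof.
move=> pp os T2.
have s1 : s != 1 by apply: contraTneq pp => e; rewrite -os e order1.
have [x sx] : exists x, s x != x.
  apply/existsP; apply: contraNT s1 => /existsPn h; apply/eqP/permP => x.
  by rewrite perm1; apply/eqP; have := h x; rewrite negbK.
have dv y : #|porbit s y| = 1%N \/ #|porbit s y| = p.
  have : #|porbit s y| %| p by rewrite -os porbitE; apply: dvdn_orbit.
  by case/primeP: pp => _ h /h /orP[] /eqP; [left | right].
have c1 y : #|porbit s y| = 1%N -> s y = y.
  move=> /eqP/cards1P[z ez].
  have : y \in porbit s y by apply: porbit_id.
  have : s y \in porbit s y by rewrite -{1}[s]expg1 mem_porbit.
  by rewrite ez !inE => /eqP-> /eqP->.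
have cx : #|porbit s x| = p by case: (dv x) => // /c1 e; rewrite e eqxx in sx.
exists x; split=> //; apply/subsetP => y; rewrite inE; apply: contraR => yx.
case: (dv y) => [/c1 -> //|cy]; exfalso.
have : #|porbit s x :|: porbit s y| <= #|T| by apply: max_card.
rewrite cardsU cx cy; suff -> : porbit s x :&: porbit s y = set0 by rewrite cards0; lia.
apply/setP => z; rewrite !inE; apply/negP => /andP[].
rewrite -!eq_porbit_mem => /eqP -> /eqP e.
by case/negP: yx; rewrite -eq_porbit_mem e.
Qed.

(** The powers of [s] are transitive on the cycle. A nontrivial power that preserves [B] generates
    [s], so [B] would be the whole cycle. *)
Lemma prime_orbit_base (s : {perm T}) p x : prime p -> #[s] = p -> s \in G ->
  #|porbit s x| = p -> perm_on (porbit s x) s ->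
  trans_on (porbit s x) /\ primitive_on (porbit s x).
Proof.
move=> pp os sG cx son.
have onX i : perm_on (porbit s x) (s ^+ i).
  by elim: i => [|i IH]; rewrite ?expg0 ?perm_on1 // expgS perm_onM.
have tr : forall y z, y \in porbit s x -> z \in porbit s x -> exists i, (s ^+ i) y = z.
  move=> y z; rewrite -eq_porbit_mem => /eqP <-.
  by move=> /porbitP[i ->]; exists i.
split=> [y z yx zx|B BD /andP[/card_gt1P[y [z [yB zB yz]]] Bp]].
  by have [i <-] := tr y z yx zx; exists (s ^+ i); rewrite groupX.
have [i ei] := tr y z (subsetP BD y yB) (subsetP BD z zB).
exists (s ^+ i); split; rewrite ?groupX ?onX //.
  by exists y; rewrite ?ei.
apply/exists_inP; apply: contraTT Bp; rewrite negb_exists_in => /forall_inP h.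
have st j : (s ^+ i ^+ j) y \in B.
  elim: j => [|j IH]; first by rewrite expg0 perm1.
  by rewrite expgSr permM; have := h _ IH; rewrite negbK.
rewrite -leqNgt; apply: subset_leq_card; apply/subsetP => w wx.
have [j ej] := tr y w (subsetP BD y yB) wx.
have si : s ^+ i != 1 by apply: contra yz => /eqP e; rewrite -ei e perm1.
have : s ^+ j \in <[s ^+ i]> by rewrite groupX // (prime_cycle_gen pp os).
by case/cycleP=> q eq; rewrite -ej eq.
Qed.

Lemma Jordan_prime (s : {perm T}) p : trans_on setT -> prime p -> #[s] = p -> s \in G ->
  #|T| < 2 * p -> seq_trans_on setT (1 + (#|T| - p)).
Proof.
move=> tG pp os sG T2; have [x [cx son]] := prime_order_orbit pp os T2.
have [tr pr] := prime_orbit_base pp os sG cx son.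
by rewrite -cx; apply: Jordan_chain => //; [apply: trans_on_seq | rewrite cx].
Qed.

Lemma logn_fact_prime p : prime p -> logn p p`! = 1%N.
Proof.
move=> pp; rewrite logn_fact // big_ltn ?ltnS ?prime_gt0 // expn1 divnn prime_gt0 //.
rewrite big1_seq // => k /=; rewrite mem_index_iota => /andP[k1 _].
by rewrite divn_small // -{1}[p]expn1 ltn_exp2l // prime_gt1.
Qed.

(* Frattini: conjugates of [s] by elements of [G] permuting the fixed points of [s] generate Sylow
   subgroups of the pointwise stabiliser of these fixed points. *)
Lemma normalizer_seq_trans (s : {perm T}) p x i : prime p -> #[s] = p -> s \in G ->
  #|porbit s x| = p -> perm_on (porbit s x) s ->
  seq_trans_on setT i -> #|T| - p <= i ->
  forall s1 s2 : seq T, perm_eq s1 (enum (~: porbit s x)) -> perm_eq s2 (enum (~: porbit s x)) ->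
  exists w : {perm T}, [/\ w \in G, w \in 'N(<[s]>) & map w s1 = s2].
Proof.
move=> pp os sG cx son sT ki s1 s2 p1 p2; set C := porbit s x in cx son p1 p2.
have [| | | | | |u [uG _ us]] := sT s1 s2.
- by rewrite (perm_uniq p1) enum_uniq.
- by rewrite (perm_uniq p2) enum_uniq.
- by rewrite (perm_size p1) (perm_size p2).
- by rewrite (perm_size p1) -cardE cardsCs setCK cx.
- by move=> ?; rewrite in_setT.
- by move=> ?; rewrite in_setT.
have m1 z : (z \in s1) = (z \notin C) by rewrite (perm_mem p1) mem_enum inE.
have m2 z : (z \in s2) = (z \notin C) by rewrite (perm_mem p2) mem_enum inE.
have uC z : (u z \in C) = (z \in C).
  by apply: negb_inj; rewrite -m2 -us mem_map ?m1 //; apply: perm_inj.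
pose K := (G :&: [group of perm.Sym C])%G.
have inK h : (h \in K) = (h \in G) && perm_on C h by rewrite !inE.
(* [K] embeds in the symmetric group of the [p] points of [C], so [p] divides its order exactly
   once. *)
have syl h : h \in K -> #[h] = p -> p.-Sylow(K) <[h]>.
  move=> hK oh; rewrite pHallE cycle_subG hK -orderE oh p_part.
  have dK : (#|K| %| p`!)%N by rewrite -cx -perm.card_Sym; apply: cardSg; apply: subsetIr.
  have dp : (p %| #|K|)%N by rewrite -oh order_dvdG.
  have l1 : (logn p #|K| <= 1)%N by rewrite -(logn_fact_prime pp) dvdn_leq_log ?fact_gt0.
  have l2 : (0 < logn p #|K|)%N by rewrite logn_gt0 mem_primes pp cardG_gt0.
  have l3 : logn p #|K| = 1%N by apply/eqP; rewrite eqn_leq l1.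
  by rewrite /= in l3 *; rewrite l3 expn1 eqxx.
have sK : s \in K by rewrite inK sG.
have suK : s ^ u \in K.
  rewrite inK groupJ //=; apply/subsetP => z; rewrite inE; apply: contraR => zC.
  rewrite conjgE !permM (out_perm son) ?permKV //.
  by rewrite -uC permKV.
have [v vK ev] := Sylow_trans (syl _ suK (etrans (orderJ _ _) os)) (syl _ sK os).
exists (u * v); split.
- by rewrite groupM //; move: vK; rewrite inK => /andP[].
- by rewrite inE conjsgM -cycleJ -ev.
rewrite -[RHS]us; apply/eq_in_map => z zs; rewrite permM (@out_perm _ C) //.
  by move: vK; rewrite inK => /andP[].
by rewrite uC -m1.
Qed.

Lemma prime_inv_mod3 p : prime p -> 3 < p -> exists e q, (p * e = (3 * q).+1)%N.
Proof.
move=> pp p3; have p3' : ~~ (3 %| p)%N by rewrite dvdn_prime2 //; lia.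
have [h|h] : (p %% 3 = 1 \/ p %% 3 = 2)%N by lia.
  by exists 1%N, (p %/ 3)%N; lia.
by exists 2%N, (p %/ 3 * 2 + 1)%N; lia.
Qed.

(** The normaliser of [<[s]>] induces all permutations of the fixed points of [s]; take [a] and [b]
    acting there as the transpositions (x y) and (y z). Their commutator is a 3-cycle there. It
    centralises [s], since the automorphisms of a cyclic group commute, so it acts on the [p]-cycle
    as a power of [s], which a suitable exponent kills. *)
Lemma three_cycle (s : {perm T}) p : trans_on setT -> prime p -> #[s] = p -> s \in G ->
  #|T| < 2 * p -> p + 3 <= #|T| ->
  exists x y z t, [/\ uniq [:: x; y; z], t \in G, [/\ t x = y, t y = z & t z = x] &
    perm_on [set x; y; z] t].
Proof.
move=> tG pp os sG T2 p3; have sT := Jordan_prime tG pp os sG T2.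
have [o [co son]] := prime_order_orbit pp os T2.
set C := porbit s o in co son.
have cF : size (enum (~: C)) = (#|T| - p)%N by rewrite -cardE cardsCs setCK co.
have uF := enum_uniq (~: C).
case eF : (enum (~: C)) cF uF => [|x [|y [|z r]]] cF uF; try (move: cF p3 => /= cF p3; lia).
move: cF uF => /= cF uF.
move: uF; rewrite !inE !negb_or => /and4P[/and3P[xy xz xr] /andP[yz yr] zr ur].
have ki : #|T| - p <= 1 + (#|T| - p) by apply: leq_addl.
have nor := normalizer_seq_trans pp os sG co son sT ki; rewrite -/C eF in nor.
have [||a [aG aN [ax ay az ar]]] := nor [:: x, y, z & r] [:: y, x, z & r] => //.
  exact: permEl (perm_catCA [:: y] [:: x] (z :: r)).
have [||b [bG bN [bx by_ bz br]]] := nor [:: x, y, z & r] [:: x, z, y & r] => //.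
  by rewrite perm_cons; exact: permEl (perm_catCA [:: z] [:: y] r).
have fixr (f : {perm T}) w : map f r = r -> w \in r -> f w = w.
  by move=> e wr; move: e; rewrite -{2}(map_id r) => /eq_in_map; apply.
have inC w : (w \in C) = [&& w != x, w != y, w != z & w \notin r].
  by apply: negb_inj; rewrite -in_setC -mem_enum eF !inE !negb_and !negbK.
pose c := [~ a, b].
have cG : c \in G by rewrite groupR.
have nX f : f \in 'N(<[s]>) -> exists m, s ^ f = s ^+ m.
  by move=> fN; apply/cycleP; rewrite memJ_norm // cycle_id.
have [[m am] [n bn]] := (nX a aN, nX b bN).
have cs : s ^ c = s.
  have e : s ^ (a * b) = s ^ (b * a).
    by rewrite !conjgM am bn !conjXg am bn -!expgM mulnC.
  have [|l el] := nX (b * a)^-1; first by rewrite groupV groupM.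
  have -> : c = (b * a)^-1 * (a * b) by rewrite /c commgEl conjgE invMg !mulgA.
  by rewrite conjgM el conjXg e -conjXg -el -conjgM mulVg conjg1.
have cE w : c (a (b w)) = b (a w).
  by rewrite -(permM a b) (commgC a b) !permM.
clearbody c.
have cx : c x = y by have := cE z; rewrite bz ay az bz.
have cy : c y = z by have := cE x; rewrite bx ax by_.
have cz : c z = x by have := cE y; rewrite by_ az ay bx.
have cr w : w \in r -> c w = w.
  by move=> wr; have := cE w; rewrite !(fixr _ _ br wr, fixr _ _ ar wr).
have nC w : w \notin C -> [\/ w = x, w = y, w = z | w \in r].
  rewrite inC !negb_and !negbK => /or4P[/eqP|/eqP|/eqP|]; by constructor.
have cF3 w : w \notin C -> c (c (c w)) = w.
  by case/nC => [->|->|->|wr]; rewrite ?cx ?cy ?cz ?cx ?cy ?cz ?cr.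
have [xC yC zC] : [/\ x \notin C, y \notin C & z \notin C].
  by rewrite !inC !eqxx /= !andbF.
have cNC w : w \notin C -> c w \notin C.
  by move=> wC; case/nC: (wC) => [->|->|->|wr]; rewrite ?cx ?cy ?cz ?cr.
have cC w : w \in C -> (c ^+ p) w = w.
  (* Off [C] the map [c] has order dividing 3 and stays off [C], so it cannot take [o] out of
     [C]. *)
  have [k ck] : exists k, c o = (s ^+ k) o.
    apply/porbitP; apply: contraT => cN; have e := perm_inj (cF3 _ cN).
    by have := cNC _ (cNC _ cN); rewrite e porbit_id.
  have com q u : c ((s ^+ q) u) = (s ^+ q) (c u).
    rewrite -!permM; congr (fun_of_perm _ u); apply/commgP/conjg_fixP.
    by rewrite conjXg cs.
  have step q u : (c ^+ q) ((s ^+ u) o) = (s ^+ (q * k)) ((s ^+ u) o).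
    elim: q => [|q IH]; first by rewrite !expg0.
    rewrite expgSr permM IH 2!com ck -!permM -!expgD.
    by congr (fun_of_perm (s ^+ _) o); clear; lia.
  by case/porbitP=> j ->; rewrite step -os mulnC expgM -expgM mulnC expgM expg_order expg1n perm1.
have p_gt3 : 3 < p by clear -T2 p3; lia.
(* The exponent [p * e] is divisible by [p] and congruent to 1 modulo 3: it trivialises [c] on [C]
   and leaves it unchanged elsewhere. *)
have [e [q eq]] := prime_inv_mod3 pp p_gt3.
have tC w : w \in C -> (c ^+ (p * e)) w = w.
  by move=> wC; rewrite expgM; elim: e {eq} => [|e IH]; rewrite ?expg0 ?perm1 // expgS permM cC.
have tF w : w \notin C -> (c ^+ (p * e)) w = c w.
  move=> wC; rewrite eq expgSr permM; congr (c _).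
  by elim: q {eq} => [|q IH]; rewrite ?muln0 ?expg0 ?perm1 //
    mulnS expgD permM !expgS expg0 !permM perm1 cF3.
exists x, y, z, (c ^+ (p * e)); split; rewrite ?groupX //.
- by rewrite /= !inE negb_or xy xz yz.
- by rewrite !tF.
apply/subsetP => w; rewrite !inE; apply: contraR; rewrite !negb_or -andbA => /and3P[wx wy wz].
case: (boolP (w \in C)) => wC; first by rewrite tC.
rewrite tF // cr //; case/nC: wC => // e'; by rewrite e' eqxx in wx wy wz.
Qed.

(** It suffices to exchange [u] in [S] for [v] outside, with [S] of half size. A third point [w]
    outside [S] is then available, and by 3-transitivity a conjugate of the 3-cycle is (u v w). *)
Lemma Jordan_homogeneous (s : {perm T}) p k : trans_on setT -> prime p -> #[s] = p -> s \in G ->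
  #|T| < 2 * p -> p + 3 <= #|T| -> k <= #|T| -> homogeneous G k.
Proof.
move=> tG pp os sG T2 p3 kT.
have [x [y [z [t [xyz tG' [tx ty tz] tS]]]]] := three_cycle tG pp os sG T2 p3.
have sT := Jordan_prime tG pp os sG T2.
have sz3 : 3 <= 1 + (#|T| - p) by clear -p3; lia.
have T4 : 4 <= #|T| by have := prime_gt1 pp; lia.
apply: (@homogeneous_half _ _ (#|T|./2)) => //; try lia.
apply: homogeneous_exchange => S u v cS uS vS.
have uv : u != v by apply: contraNneq vS => <-.
have [w] : exists w, w \in ~: (v |: S).
  apply/card_gt0P; rewrite cardsCs setCK cardsU1 vS cS; clear -T4; lia.
rewrite !inE negb_or => /andP[wv wS].
have uw : u != w by apply: contraNneq wS => <-.
have [| | | | | |g [gG _ [gx gy gz]]] := sT [:: x; y; z] [:: u; v; w] => //.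
- by rewrite /= !inE negb_or uv uw eq_sym wv.
- by move=> ?; rewrite in_setT.
- by move=> ?; rewrite in_setT.
exists (t ^ g); first by rewrite groupJ.
have [hu hv hw] : [/\ (t ^ g) u = v, (t ^ g) v = w & (t ^ g) w = u].
  by rewrite -gx -gy -gz !conjgE !permM !permK tx ty tz.
have ho a : a != u -> a != v -> a != w -> (t ^ g) a = a.
  move=> au av aw; rewrite conjgE !permM (out_perm tS) ?permKV //.
  have K b : (g^-1 a == b) = (a == g b) by rewrite -(inj_eq (@perm_inj _ g)) permKV.
  by rewrite !inE !negb_or !K gx gy gz au av aw.
have E : [set (t ^ g) b | b in S :\ u] = S :\ u.
  rewrite -[RHS]imset_id; apply: eq_in_imset => b; rewrite !inE => /andP[bu bS].
  by rewrite ho //; [apply: contraNneq vS => <- | apply: contraNneq wS => <-].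
rewrite -{1}(setD1K uS) imsetU1 E hu //.
Qed.

End Jordan.

(** * Six points *)

Lemma perm_extends (T : finType) (s t : seq T) :
  uniq s -> uniq t -> size s = size t -> exists q : {perm T}, map q s = t.
Proof.
elim: s t => [|x s IH] [|y t] //=; first by exists 1%g.
move=> /andP[xs us] /andP[yt ut] [sst]; have [q qs] := IH t us ut sst.
exists (q * tperm (q x) y)%g; rewrite permM tpermL; congr (_ :: _).
rewrite -qs; apply/eq_in_map => z zs; rewrite permM tpermD //.
  by rewrite (inj_eq perm_inj); apply: contraNneq xs => ->.
by apply: contraNneq yt => ->; rewrite -qs map_f.
Qed.

Lemma mem_uniq_full (T : finType) (s : seq T) x : uniq s -> size s = #|T| -> x \in s.
Proof.
move=> us ss; have -> // : s =i T.
by apply/subset_cardP; [rewrite (card_uniqP us) | apply/subsetP].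
Qed.

Lemma uniq_reindex (T : eqType) (x0 : T) (s : seq T) (p : seq nat) :
  uniq s -> perm_eq (iota 0 (size s)) p -> uniq (map (nth x0 s) p).
Proof.
by move=> us pp; rewrite -(perm_uniq (perm_map _ pp)) map_nth_iota0 // take_size.
Qed.

Lemma card_uniq_full (T : finType) (s : seq T) (P : pred T) :
  uniq s -> size s = #|T| -> #|P| = count P s.
Proof.
move=> us ss; rewrite -size_filter -(card_uniqP (filter_uniq P us)); apply: eq_card => x.
by rewrite mem_filter mem_uniq_full // andbT.
Qed.

Section SixPoints.
Variables (T : eqType) (o : T -> T -> T -> nat) (l : nat).
Hypotheses (sL : forall x y z, o x y z = o y x z) (sR : forall x y z, o x y z = o x z y).
Hypothesis o1 : forall x y z, o x y z <= 1.
Hypothesis H : forall x y z u v w, uniq [:: x; y; z; u; v; w] ->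
  o x y z + o x y u + o x y v + o x y w = l.

(* [o] is the indicator of an orbit of 3-sets that covers each pair [l] times.  The equalities to
   [1] say that of two transversals of [{x0,x1 | x2,x3 | x4,x5}] which differ in one place exactly
   one belongs to the orbit. *)
Lemma six_pair_sums x0 x1 x2 x3 x4 x5 : uniq [:: x0; x1; x2; x3; x4; x5] ->
  2 * (o x0 x1 x2 + o x3 x4 x5) = l /\
  (l = 2 -> o x0 x1 x2 = 1 -> o x0 x1 x3 = 1 ->
   [/\ [/\ o x0 x2 x4 + o x1 x2 x4 = 1, o x0 x2 x5 + o x1 x2 x5 = 1, o x0 x3 x4 + o x1 x3 x4 = 1 &
            o x0 x3 x5 + o x1 x3 x5 = 1],
       [/\ o x0 x2 x4 + o x0 x3 x4 = 1, o x0 x2 x5 + o x0 x3 x5 = 1, o x1 x2 x4 + o x1 x3 x4 = 1 &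
            o x1 x2 x5 + o x1 x3 x5 = 1] &
       [/\ o x0 x2 x4 + o x0 x2 x5 = 1, o x0 x3 x4 + o x0 x3 x5 = 1, o x1 x2 x4 + o x1 x2 x5 = 1 &
            o x1 x3 x4 + o x1 x3 x5 = 1]]).
Proof.
move=> us.
have U := fun p => @uniq_reindex _ x0 _ p us.
(* The fifteen pair equations, with the arguments of [o] sorted by index so that only twenty
   unknowns occur. *)
have := @H x0 x1 x2 x3 x4 x5 (U [:: 0; 1; 2; 3; 4; 5] isT).
move=> e01.
have := @H x0 x2 x1 x3 x4 x5 (U [:: 0; 2; 1; 3; 4; 5] isT).
rewrite (sR x0 x2 x1).
move=> e02.
have := @H x0 x3 x1 x2 x4 x5 (U [:: 0; 3; 1; 2; 4; 5] isT).
rewrite (sR x0 x3 x1) (sR x0 x3 x2).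
move=> e03.
have := @H x0 x4 x1 x2 x3 x5 (U [:: 0; 4; 1; 2; 3; 5] isT).
rewrite (sR x0 x4 x1) (sR x0 x4 x2) (sR x0 x4 x3).
move=> e04.
have := @H x0 x5 x1 x2 x3 x4 (U [:: 0; 5; 1; 2; 3; 4] isT).
rewrite (sR x0 x5 x1) (sR x0 x5 x2) (sR x0 x5 x3) (sR x0 x5 x4).
move=> e05.
have := @H x1 x2 x0 x3 x4 x5 (U [:: 1; 2; 0; 3; 4; 5] isT).
rewrite (sR x1 x2 x0) (sL x1 x0 x2).
move=> e12.
have := @H x1 x3 x0 x2 x4 x5 (U [:: 1; 3; 0; 2; 4; 5] isT).
rewrite (sR x1 x3 x0) (sL x1 x0 x3) (sR x1 x3 x2).
move=> e13.
have := @H x1 x4 x0 x2 x3 x5 (U [:: 1; 4; 0; 2; 3; 5] isT).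
rewrite (sR x1 x4 x0) (sL x1 x0 x4) (sR x1 x4 x2) (sR x1 x4 x3).
move=> e14.
have := @H x1 x5 x0 x2 x3 x4 (U [:: 1; 5; 0; 2; 3; 4] isT).
rewrite (sR x1 x5 x0) (sL x1 x0 x5) (sR x1 x5 x2) (sR x1 x5 x3) (sR x1 x5 x4).
move=> e15.
have := @H x2 x3 x0 x1 x4 x5 (U [:: 2; 3; 0; 1; 4; 5] isT).
rewrite (sR x2 x3 x0) (sL x2 x0 x3) (sR x2 x3 x1) (sL x2 x1 x3).
move=> e23.
have := @H x2 x4 x0 x1 x3 x5 (U [:: 2; 4; 0; 1; 3; 5] isT).
rewrite (sR x2 x4 x0) (sL x2 x0 x4) (sR x2 x4 x1) (sL x2 x1 x4) (sR x2 x4 x3).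
move=> e24.
have := @H x2 x5 x0 x1 x3 x4 (U [:: 2; 5; 0; 1; 3; 4] isT).
rewrite (sR x2 x5 x0) (sL x2 x0 x5) (sR x2 x5 x1) (sL x2 x1 x5) (sR x2 x5 x3) (sR x2 x5 x4).
move=> e25.
have := @H x3 x4 x0 x1 x2 x5 (U [:: 3; 4; 0; 1; 2; 5] isT).
rewrite (sR x3 x4 x0) (sL x3 x0 x4) (sR x3 x4 x1) (sL x3 x1 x4) (sR x3 x4 x2) (sL x3 x2 x4).
move=> e34.
have := @H x3 x5 x0 x1 x2 x4 (U [:: 3; 5; 0; 1; 2; 4] isT).
rewrite (sR x3 x5 x0) (sL x3 x0 x5) (sR x3 x5 x1) (sL x3 x1 x5) (sR x3 x5 x2) (sL x3 x2 x5)
  (sR x3 x5 x4).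
move=> e35.
have := @H x4 x5 x0 x1 x2 x3 (U [:: 4; 5; 0; 1; 2; 3] isT).
rewrite (sR x4 x5 x0) (sL x4 x0 x5) (sR x4 x5 x1) (sL x4 x1 x5) (sR x4 x5 x2) (sL x4 x2 x5)
  (sR x4 x5 x3) (sL x4 x3 x5).
move=> e45.
split; first lia.
have b012 := o1 x0 x1 x2.
have b013 := o1 x0 x1 x3.
have b014 := o1 x0 x1 x4.
have b015 := o1 x0 x1 x5.
have b023 := o1 x0 x2 x3.
have b024 := o1 x0 x2 x4.
have b025 := o1 x0 x2 x5.
have b034 := o1 x0 x3 x4.
have b035 := o1 x0 x3 x5.
have b045 := o1 x0 x4 x5.
have b123 := o1 x1 x2 x3.
have b124 := o1 x1 x2 x4.
have b125 := o1 x1 x2 x5.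
have b134 := o1 x1 x3 x4.
have b135 := o1 x1 x3 x5.
have b145 := o1 x1 x4 x5.
have b234 := o1 x2 x3 x4.
have b235 := o1 x2 x3 x5.
have b245 := o1 x2 x4 x5.
have b345 := o1 x3 x4 x5.
move=> l2 h2 h3; do !split; lia.
Qed.
End SixPoints.

(** The kernels of the maps [a \o q] are the images of the kernel of [a] under the symmetric group;
    [G] is transitive on them. *)
Definition ker_homogeneous (T : finType) (R : eqType) (G : {group {perm T}}) (a : T -> R) :=
  forall q : {perm T}, exists2 g : {perm T}, g \in G &
    forall x y, (a (g x) == a (g y)) = (a (q x) == a (q y)).

(** * Kernels consisting of three pairs on six points *)

Section PairKernel.
Variables (T : finType) (R : eqType) (G : {group {perm T}}) (a : T -> R).
Hypotheses (T6 : #|T| = 6) (a2 : forall x, #|[set y | a y == a x]| = 2).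
Hypothesis aG : ker_homogeneous G a.

Lemma pair_kernel_partner x : exists2 y, y != x & a y = a x.
Proof.
have /eqP/cards2P[u [v [uv e]]] := a2 x.
have au : a u = a x by apply/eqP; have /setP/(_ u) := e; rewrite !inE eqxx.
have av : a v = a x by apply/eqP; have /setP/(_ v) := e; rewrite !inE eqxx orbT.
have [xu|xu] := eqVneq x u; last by exists u; rewrite // eq_sym.
by exists v => //; rewrite xu eq_sym.
Qed.

Lemma pair_kernel_only x y z : y != x -> a y = a x -> a z = a x -> z = x \/ z = y.
Proof.
move=> yx ay az; case: (z =P x) => [|/eqP zx]; [by left|right].
apply/eqP; apply: contraT => zy.
have : #|z |: [set x; y]| <= #|[set w | a w == a x]|.
  apply: subset_leq_card; apply/subsetP => w.
  by rewrite !inE => /or3P[] /eqP->; rewrite ?ay ?az ?eqxx.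
by rewrite a2 cardsU1 cards2 !inE negb_or zx zy eq_sym yx.
Qed.

(** The kernel classes of [a] are three pairs; a permutation taking the given pairs to them can be
    replaced by a member of [G] that induces the same kernel. *)
Lemma pair_kernel_matching x0 x1 x2 x3 x4 x5 : uniq [:: x0; x1; x2; x3; x4; x5] ->
  exists2 g : {perm T}, g \in G &
    [/\ a (g x1) = a (g x0), a (g x3) = a (g x2) & a (g x5) = a (g x4)] /\
    [/\ a (g x0) != a (g x2), a (g x0) != a (g x4) & a (g x2) != a (g x4)].
Proof.
move=> us.
have pick (s : seq T) : size s < 6 -> exists x, x \notin s.
  move=> s6; have /existsP[x xs] : [exists x, x \notin s]; last by exists x.
  apply: contraLR s6; rewrite negb_exists => /forallP h; rewrite -leqNgt -T6.
  apply: leq_trans (card_size s); apply: subset_leq_card; apply/subsetP => x _.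
  by have := h x; rewrite negbK.
have [y0 _] := pick [::] isT.
have [y1 y10 a1] := pair_kernel_partner y0.
have [y2 h2] := pick [:: y0; y1] isT.
have [y3 y32 a3] := pair_kernel_partner y2.
have [y4 h4] := pick [:: y0; y1; y2; y3] isT.
have [y5 y54 a5] := pair_kernel_partner y4.
have n02 : a y0 != a y2.
  apply: contra h2 => /eqP/esym e; rewrite !inE.
  by have [->|->] := pair_kernel_only y10 a1 e; rewrite eqxx ?orbT.
have n04 : a y0 != a y4.
  apply: contra h4 => /eqP/esym e; rewrite !inE.
  by have [->|->] := pair_kernel_only y10 a1 e; rewrite eqxx ?orbT.
have n24 : a y2 != a y4.
  apply: contra h4 => /eqP/esym e; rewrite !inE.
  by have [->|->] := pair_kernel_only y32 a3 e; rewrite eqxx ?orbT.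
have ne u v : a u != a v -> u != v by apply: contraNneq => ->.
have uy : uniq [:: y0; y1; y2; y3; y4; y5].
  rewrite /= !inE !negb_or (eq_sym y0 y1) y10 (eq_sym y2 y3) y32 (eq_sym y4 y5) y54.
  by rewrite !ne // ?a1 ?a3 ?a5.
have [q [e0 e1 e2 e3 e4 e5]] := perm_extends us uy (erefl 6).
have [g gG gq] := aG q; exists g => //.
split; first by split; apply/eqP; rewrite gq ?e0 ?e1 ?e2 ?e3 ?e4 ?e5 ?a1 ?a3 ?a5.
by split; rewrite gq ?e0 ?e2 ?e4.
Qed.

(* A proper orbit of 3-sets contains some [{y,z,u}] and [{y,z,u'}], hence two transversals of
   [{u,u' | y,v | z,v'}] which differ in one place, but not so for [{y,z | u,u' | v,v'}]. *)
Lemma pair_kernel_homogeneous : homogeneous G 2 -> homogeneous G 3.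
Proof.
move=> h2 S S' cS cS'; set O := set_orbit G S.
suff /exists_inP[g gG /eqP <-] : O S' by exists g.
apply: contraT => nO; exfalso.
pose o x y z := nat_of_bool (O [set x; y; z]).
have sL x y z : o x y z = o y x z by rewrite /o [[set x; y]]setUC.
have sR x y z : o x y z = o x z y by rewrite /o -!setUA [[set y] :|: _]setUC.
have o1 x y z : o x y z <= 1 by apply: leq_b1.
have oG (g : {perm T}) x y z : g \in G -> o (g x) (g y) (g z) = o x y z.
  by move=> gG; rewrite /o /O -(set_orbit_imset S [set x; y; z] gG) !imsetU !imset_set1.
(* The number of points completing a pair to a 3-set of the orbit; by 2-homogeneity it is a constant
   [l]. *)
pose cnt (D : {set T}) := #|[pred w | (w \notin D) && O (D :|: [set w])]|.
have cntG (D D' : {set T}) : #|D| = 2 -> #|D'| = 2 -> cnt D = cnt D'.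
  move=> cD cD'; have [g gG <-] := h2 D D' cD cD'.
  rewrite /cnt -(card_imset _ (@perm_inj _ g)); apply: eq_card => w.
  rewrite -[w](permKV g) mem_imset; last exact: perm_inj.
  rewrite !inE mem_imset; last exact: perm_inj.
  by rewrite -[O (D :|: _)](set_orbit_imset S _ gG) imsetU imset_set1.
have [l lE] : exists l, forall D : {set T}, #|D| = 2 -> cnt D = l.
  have [D cD] : exists D : {set T}, #|D| = 2.
    have : 0 < #|[set A : {set T} | #|A| == 2]| by rewrite card_draws T6.
    by case/card_gt0P => D; rewrite inE => /eqP cD; exists D.
  by exists (cnt D) => D' cD'; apply: cntG.
have H x y z u v w : uniq [:: x; y; z; u; v; w] -> o x y z + o x y u + o x y v + o x y w = l.
  move=> us; have xy : x != y by move: us; rewrite /= !inE !negb_or => /andP[/andP[]].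
  rewrite -(lE [set x; y]) ?cards2 ?xy // /cnt (card_uniq_full _ us) ?T6 //= !inE !eqxx.
  move: us; rewrite /= !inE !negb_or => /and5P[/and5P[_ xz xu xv xw] /and4P[yz yu yv yw] _ _ _].
  rewrite !(eq_sym _ x) !(eq_sym _ y) (negPf xz) (negPf xu) (negPf xv) (negPf xw).
  rewrite (negPf yz) (negPf yu) (negPf yv) (negPf yw) /= andbF /= !add0n addn0.
  by rewrite !addnA.
have lab (K : {set T}) : #|K| = 3 -> exists x0 x1 x2 x3 x4 x5,
    uniq [:: x0; x1; x2; x3; x4; x5] /\ K = [set x0; x1; x2].
  move=> cK; have := enum_uniq K; have := enum_uniq (~: K).
  have := cardE K; have := cardE (~: K); rewrite cardsCs setCK cK T6.
  have mC x : (x \in enum (~: K)) = (x \notin enum K) by rewrite !mem_enum inE.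
  have mK x : (x \in K) = (x \in enum K) by rewrite mem_enum.
  move: (enum (~: K)) (enum K) mC mK => e2 e1 mC mK.
  case: e1 mC mK => [|x0 [|x1 [|x2 [|? ?]]]] mC mK //; case: e2 mC => [|x3 [|x4 [|x5 [|? ?]]]] mC //.
  move=> _ _ u2 u1; exists x0, x1, x2, x3, x4, x5; split.
    rewrite -[_ :: _]/([:: x0; x1; x2] ++ [:: x3; x4; x5]) cat_uniq u1 u2 andbT.
    by apply/hasPn => w; rewrite mC.
  by apply/setP => x; rewrite mK !inE orbA.
(* In [2 * (o x0 x1 x2 + o x3 x4 x5) = l], a 3-set in the orbit gives at least 2 and one outside it
   at most 2. *)
have l2 : l = 2.
  have [x0 [x1 [x2 [x3 [x4 [x5 [us e]]]]]]] := lab S cS.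
  have [y0 [y1 [y2 [y3 [y4 [y5 [us' e']]]]]]] := lab S' cS'.
  have [h _] := six_pair_sums sL sR o1 H us.
  have [h' _] := six_pair_sums sL sR o1 H us'.
  move: h h'; have -> : o x0 x1 x2 = 1 by rewrite /o -e /O set_orbit_refl.
  have -> : o y0 y1 y2 = 0 by rewrite /o -e' (negPf nO).
  by have := o1 x3 x4 x5; have := o1 y3 y4 y5; clear; lia.
have O1 K : O K -> exists x0 x1 x2 x3 x4 x5, uniq [:: x0; x1; x2; x3; x4; x5] /\
    o x0 x1 x2 = 1 /\ o x0 x1 x3 = 1.
  move=> OK.
  have cK : #|K| = 3.
    by case/exists_inP: OK => g _ /eqP <-; rewrite card_imset //; apply: perm_inj.
  have [y [z [u [r1 [r2 [r3 [us e]]]]]]] := lab K cK.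
  have e1 : o y z u = 1 by rewrite /o -e OK.
  have := @H _ _ _ _ _ _ us; rewrite l2 e1.
  have [b1 b2 b3] := (o1 y z r1, o1 y z r2, o1 y z r3).
  case: (o y z r1 =P 1) => [h1|h1]; first by exists y, z, u, r1, r2, r3.
  case: (o y z r2 =P 1) => [h2'|h2'].
    exists y, z, u, r2, r1, r3; split => //.
    exact: (@uniq_reindex _ y _ [:: 0; 1; 2; 4; 3; 5] us).
  case: (o y z r3 =P 1) => [h3|h3]; last by move: b1 b2 b3 h1 h2' h3; clear; lia.
  exists y, z, u, r3, r1, r2; split => //.
  exact: (@uniq_reindex _ y _ [:: 0; 1; 2; 5; 3; 4] us).
have [y [z [u [u' [v [v' [us [yzu yzu']]]]]]]] := O1 S (set_orbit_refl G S).
have [_ /(_ l2 yzu yzu') T1] := six_pair_sums sL sR o1 H us.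
have us2 : uniq [:: u; u'; y; v; z; v'] := @uniq_reindex _ y _ [:: 2; 3; 0; 4; 1; 5] us isT.
have [g1 g1G [[k1 k2 k3] [n1 n2 n3]]] := pair_kernel_matching us.
have [g2 g2G [[m1 m2 m3] [d1 d2 d3]]] := pair_kernel_matching us2.
(* [h] carries the matching {u,u' | y,v | z,v'} to {y,z | u,u' | v,v'}. *)
pose h := (g2 * g1^-1)%g.
have hG : h \in G by rewrite groupM ?groupV.
have E x : g1 (h x) = g2 x by rewrite /h permM permKV.
have X1 : o (h u) (h y) (h z) = 1 by rewrite oG // sR sL sR -yzu sL sR.
have X2 : o (h u') (h y) (h z) = 1 by rewrite oG // -yzu' [RHS]sR sL sR.
have ful x : x \in [:: y; z; u; u'; v; v'].
  by apply: mem_uniq_full; rewrite ?T6.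
have nu : h u != h u'.
  by rewrite (inj_eq (@perm_inj _ h)); move: us2; rewrite /= !inE !negb_or => /andP[/andP[]].
have [a1 a2' a3 a4] : [/\ a (g1 (h u')) = a (g1 (h u)), a (g1 (h y)) != a (g1 (h u)),
    a (g1 (h z)) != a (g1 (h u)) & a (g1 (h y)) != a (g1 (h z))].
  by rewrite !E; split; rewrite // eq_sym.
have [[[fA fA'] fB] fC] := (ful (h u), ful (h u'), ful (h y), ful (h z)).
move: (h u) (h u') (h y) (h z) X1 X2 nu a1 a2' a3 a4 fA fA' fB fC.
move=> A A' B C X1 X2 nu /eqP a1 a2' a3 a4 fA fA' fB fC.
pose F := (k1, k2, k3, eqxx, negPf n1, negPf n2, negPf n3,
  eq_sym (a (g1 u)) (a (g1 y)), eq_sym (a (g1 v)) (a (g1 y)), eq_sym (a (g1 v)) (a (g1 u))).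
have [[t1 t2 t3 t4] [t5 t6 t7 t8] [t9 t10 t11 t12]] := T1.
have split6 z0 : z0 \in [:: y; z; u; u'; v; v'] ->
    [\/ [\/ z0 = y, z0 = z | z0 = u], z0 = u', z0 = v | z0 = v'].
  rewrite !inE => /or4P[/eqP|/eqP|/eqP|]; [by do 2!constructor..|].
  by case/or3P => /eqP; [constructor 2 | constructor 3 | constructor 4].
(* [A], [A'] form a pair of the first matching and [B], [C] lie in the two other pairs, so [X1] and
   [X2] contradict one of the equations [t1] to [t12]. Alternating [sL] and [sR] runs through all
   six orders of the arguments. *)
case/split6: fA => [[]|||] ?; subst A; case/split6: fA' => [[]|||] ?; subst A';
  (try by move: nu; rewrite eqxx); (try by move: a1; rewrite !F);
  case/split6: fB => [[]|||] ?; subst B; (try by move: a2'; rewrite !F);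
  case/split6: fC => [[]|||] ?; subst C;
  (try by move: a3; rewrite !F); (try by move: a4; rewrite !F);
  (try by clear -t1 t2 t3 t4 t5 t6 t7 t8 t9 t10 t11 t12 X1 X2; lia);
  rewrite sL in X1; rewrite sL in X2;
  (try by clear -t1 t2 t3 t4 t5 t6 t7 t8 t9 t10 t11 t12 X1 X2; lia);
  rewrite sR in X1; rewrite sR in X2;
  (try by clear -t1 t2 t3 t4 t5 t6 t7 t8 t9 t10 t11 t12 X1 X2; lia);
  rewrite sL in X1; rewrite sL in X2;
  (try by clear -t1 t2 t3 t4 t5 t6 t7 t8 t9 t10 t11 t12 X1 X2; lia);
  rewrite sR in X1; rewrite sR in X2;
  (try by clear -t1 t2 t3 t4 t5 t6 t7 t8 t9 t10 t11 t12 X1 X2; lia);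
  rewrite sL in X1; rewrite sL in X2;
  (try by clear -t1 t2 t3 t4 t5 t6 t7 t8 t9 t10 t11 t12 X1 X2; lia).
Qed.
End PairKernel.

(** * Kernel types *)

(** Homogeneity is a finite, hence decidable, condition; this licenses the proofs by contradiction
    below. *)
Lemma homogeneous_contra (T : finType) (G : {group {perm T}}) k :
  (~ homogeneous G k -> False) -> homogeneous G k.
Proof.
pose b := [forall S : {set T}, forall R : {set T}, (#|S| == k) && (#|R| == k) ==>
  [exists g in G, [set (g : {perm T}) x | x in S] == R]].
have bP : reflect (homogeneous G k) b.
  apply: (iffP forallP) => [h S R cS cR|h S].
    have /forallP/(_ R) := h S; rewrite cS cR !eqxx /= => /exists_inP[g gG /eqP e].
    by exists g.
  apply/forallP => R; apply/implyP => /andP[/eqP cS /eqP cR].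
  by have [g gG e] := h S R cS cR; apply/exists_inP; exists g => //; apply/eqP.
by case: bP => // nh /(_ nh).
Qed.

Lemma perm_imset_extends (T : finType) (S R : {set T}) :
  #|S| <= #|R| -> exists q : {perm T}, [set q x | x in S] \subset R.
Proof.
move=> SR; have [|||q qs] := @perm_extends T (enum S) (take #|S| (enum R)).
- exact: enum_uniq.
- exact: take_uniq (enum_uniq _).
- by rewrite size_take_min -!cardE (minn_idPl SR).
exists q; apply/subsetP => y /imsetP[x xS ->].
have : q x \in map q (enum S) by rewrite map_f ?mem_enum.
by rewrite qs => /mem_take; rewrite mem_enum.
Qed.

Section Fibers.
Variable T : finType.
Implicit Types a b : {ffun T -> T}.

Definition rank a := #|[set a x | x in [set: T]]|.
Definition fiber a x := [set y | a y == a x].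
Definition level a d := [set x | #|fiber a x| == d].
(** The kernel of [b] contains a permuted copy of the kernel of [a]. By [coarser_gen] this puts [b]
    in the semigroup generated by a singular [a] and the permutations. *)
Definition coarser a b := exists (h : T -> T) (q : {perm T}), forall x, b x = h (a (q x)).

Lemma fiber_id a x : x \in fiber a x. Proof. by rewrite inE. Qed.

Lemma rank_lt a : ~ injective a -> rank a < #|T|.
Proof.
move=> na; rewrite -cardsT ltn_neqAle /rank leq_imset_card andbT; apply/negP => /imset_injP h.
by apply: na => x y; apply: h; rewrite in_setT.
Qed.

Lemma level1P a x y : x \in level a 1 -> a y = a x -> y = x.
Proof.
rewrite inE => /cards1P[z e] yx.
have : y \in fiber a x by rewrite inE yx.
by have := fiber_id a x; rewrite e !inE => /eqP-> /eqP->.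
Qed.

Lemma level1I a x : (forall y, a y = a x -> y = x) -> x \in level a 1.
Proof.
move=> h; rewrite inE; apply/cards1P; exists x; apply/setP => y; rewrite !inE.
by apply/eqP/eqP => [/h|->].
Qed.

Lemma level1_lt a : ~ injective a -> #|level a 1| < #|T|.
Proof.
move=> na; rewrite ltnNge; apply/negP => h; apply: na => x y xy.
apply: (@level1P a y x) => //.
have -> : level a 1 = setT by apply/eqP; rewrite eqEcard subsetT cardsT.
by rewrite in_setT.
Qed.

Lemma rank_setU a (D : {set T}) :
  rank a <= #|[set a x | x in D]| + #|[set a x | x in ~: D]|.
Proof. by rewrite /rank -(setUCr D) imsetU cardsU leq_subr. Qed.

Lemma rank_level1 a : rank a = #|level a 1| + #|[set a x | x in ~: level a 1]|.
Proof.
rewrite /rank -(setUCr (level a 1)) imsetU cardsU.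
rewrite (_ : _ :&: _ = set0) ?cards0 ?subn0; last first.
  apply/setP => y; rewrite !inE; apply/negP => /andP[/imsetP[x x1 ->] /imsetP[z z1 e]].
  by move: z1; rewrite inE (level1P x1 (esym e)) x1.
by rewrite card_in_imset // => x y x1 _ e; apply/esym/(level1P x1).
Qed.

Lemma rank_fiber a x : rank a <= (#|T| - #|fiber a x|).+1.
Proof.
apply: leq_trans (rank_setU a (fiber a x)) _; rewrite -add1n leq_add //.
  rewrite -(cards1 (a x)); apply: subset_leq_card; apply/subsetP => y /imsetP[z].
  by rewrite !inE => /eqP <- ->.
by apply: leq_trans (leq_imset_card _ _) _; rewrite [#|~: _|]cardsCs setCK.
Qed.

(** Equality in [rank_fiber] forces [a] to be injective off the class of [x] and to take other
    values there. *)
Lemma rank_fiber_eq a x : rank a = (#|T| - #|fiber a x|).+1 -> ~: fiber a x \subset level a 1.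
Proof.
move=> e; have cC : #|~: fiber a x| = #|T| - #|fiber a x| by rewrite [#|~: _|]cardsCs setCK.
have : #|[set a y | y in ~: fiber a x]| == #|~: fiber a x|.
  rewrite eqn_leq leq_imset_card /= cC -ltnS -e.
  apply: leq_trans (rank_setU a (fiber a x)) _; rewrite -add1n leq_add2r.
  rewrite -(cards1 (a x)); apply: subset_leq_card; apply/subsetP => y /imsetP[z].
  by rewrite !inE => /eqP <- ->.
move/imset_injP => inj; apply/subsetP => y yx; apply: level1I => z zy.
by apply: inj => //; move: yx; rewrite !inE zy.
Qed.

Lemma coarserI a b (q : {perm T}) :
  (forall x y, a (q x) = a (q y) -> b x = b y) -> coarser a b.
Proof.
move=> h; exists (fun z => if [pick x | a (q x) == z] is Some x then b x else z), q => x.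
by case: pickP => [y /eqP/h //|/(_ x)]; rewrite eqxx.
Qed.

(** The kernel of [b] has one class besides the singletons in [E]; a permutation taking [E] into the
    singleton classes of [a] is enough. *)
Lemma coarser_hook a b (E : {set T}) : E \subset level b 1 -> #|E| <= #|level a 1| ->
  (forall x y, x \notin E -> y \notin E -> b x = b y) -> coarser a b.
Proof.
move=> Eb Ea hb; have [q qE] := perm_imset_extends Ea.
have qa x : x \in E -> q x \in level a 1 by move=> xE; apply: (subsetP qE); apply: imset_f.
apply: (@coarserI a b q) => x y xy.
case: (boolP (x \in E)) => xE; first by rewrite -(perm_inj (level1P (qa x xE) (esym xy))).
case: (boolP (y \in E)) => yE; first by rewrite (perm_inj (level1P (qa y yE) xy)).
exact: hb.
Qed.

Lemma fiber_perm (f g : T -> T) :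
  (forall y, #|[set x | f x == y]| = #|[set x | g x == y]|) ->
  exists q : {perm T}, forall x, f (q x) = g x.
Proof.
move=> h; pose F (k : T -> T) y := enum [set x | k x == y].
have sF y : size (F f y) = size (F g y) by rewrite -!cardE h.
have mF k x y : (x \in F k y) = (k x == y) by rewrite mem_enum inE.
(* The i-th point of a fibre of [g] goes to the i-th point of the fibre of [f] over the same
   value. *)
pose q x := nth x (F f (g x)) (index x (F g (g x))).
have lt x : index x (F g (g x)) < size (F f (g x)) by rewrite sF index_mem mF.
have fq x : f (q x) = g x by apply/eqP; rewrite -mF mem_nth.
have qi : injective q.
  move=> x y e; have gxy : g x = g y by rewrite -!fq e.
  have := lt y; have := lt x; move: e; rewrite /q -gxy => e lx ly.
  rewrite (set_nth_default x y ly) in e.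
  have := nth_uniq x lx ly (enum_uniq _); rewrite e eqxx => /esym/eqP ei.
  have xF : x \in F g (g x) by rewrite mF.
  have yF : y \in F g (g x) by rewrite mF gxy.
  by rewrite -(nth_index x xF) ei nth_index.
by exists (perm qi) => x; rewrite permE.
Qed.

Lemma coarser_uniform a b d : (forall x, #|fiber a x| = d) -> (forall x, #|fiber b x| = d) ->
  rank a = rank b -> coarser a b.
Proof.
move=> ad bd rab.
have [p hp] := @perm_imset_extends T [set b x | x in [set: T]] [set a x | x in [set: T]]
  (eq_leq (esym rab)).
have pim : [set p x | x in [set b x | x in [set: T]]] = [set a x | x in [set: T]].
  apply/eqP; rewrite eqEcard hp (card_imset _ (@perm_inj _ p)).
  by move: rab; rewrite /rank => ->; rewrite leqnn.
have [q hq] : exists q : {perm T}, forall x, a (q x) = p (b x).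
  apply: fiber_perm => y; case: (boolP (y \in [set a x | x in [set: T]])) => ya.
    case/imsetP: (ya) => x _ ey; rewrite {1}ey ad.
    move: ya; rewrite -{1}pim => /imsetP[_ /imsetP[z _ ->] ->]; rewrite -(bd z).
    by apply: eq_card => w; rewrite !inE (inj_eq perm_inj).
  rewrite !eq_card0 // => x; rewrite !inE; apply/negP => /eqP e; case/negP: ya; rewrite -e.
    by rewrite -pim; do 2!apply: imset_f.
  exact: imset_f.
by exists (p^-1)%g, q => x; rewrite hq permK.
Qed.

Lemma card_fibers a (D : {set T}) :
  #|D| = \sum_(y in [set a x | x in D]) #|[set x in D | a x == y]|.
Proof.
rewrite -sum1_card (partition_big_imset a); apply: eq_bigr => y _ /=.
by rewrite -sum1_card; apply: eq_bigl => x; rewrite !inE.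
Qed.

Lemma uniform_card a d : (forall x, #|fiber a x| = d) -> #|T| = rank a * d.
Proof.
move=> ad; rewrite -cardsT (card_fibers a) -sum_nat_const; apply: eq_bigr => y /imsetP[x _ ->].
by rewrite -(ad x); apply: eq_card => z; rewrite !inE.
Qed.

Variable G : {group {perm T}}.

(** A level depends on the kernel only, and every set of its size is the level of some permuted copy
    of the kernel. *)
Lemma level_homogeneous a d : ker_homogeneous G a -> homogeneous G #|level a d|.
Proof.
move=> aG.
have one (S : {set T}) : #|S| = #|level a d| ->
    exists2 g : {perm T}, g \in G & [set g x | x in S] = level a d.
  move=> cS; have [q qS] := perm_imset_extends (eq_leq cS).
  have {}qS : [set q x | x in S] = level a d.
    by apply/eqP; rewrite eqEcard qS (card_imset _ (@perm_inj _ q)) cS leqnn.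
  have [g gG gq] := aG q; exists g => //; rewrite -qS.
  have fg (f : {perm T}) x : #|fiber a (f x)| = #|[set y | a (f y) == a (f x)]|.
    rewrite -[RHS](card_imset _ (@perm_inj _ f)); apply: eq_card => y.
    by rewrite -[y](permKV f) (mem_imset _ _ (@perm_inj _ f)) !inE.
  apply/setP => x; rewrite -[x](permKV g) (mem_imset _ _ (@perm_inj _ g)); set y := (g^-1)%g x.
  rewrite qS inE fg -(mem_imset _ _ (@perm_inj _ q)) qS inE fg.
  by congr (_ == _); apply: eq_card => z; rewrite !inE gq.
move=> S R cS cR; have [g gG gS] := one S cS; have [h hG hR] := one R cR.
exists (g * h^-1)%g; first by rewrite groupM ?groupV.
by rewrite imset_permM gS -hR -imset_permM mulgV imset_perm1.
Qed.

(** If [s] keeps one point of its [p]-cycle in its class, the cycle lies in that class. Otherwise no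
    two points of the cycle are equivalent, nor is any equivalent to a fixed point of [s], so all of
    them are singleton classes. *)
Lemma prime_order_ker a p (s : {perm T}) : prime p -> #[s]%g = p -> #|T| < 2 * p ->
  (forall x y, (a (s x) == a (s y)) = (a x == a y)) ->
  (exists x, p <= #|fiber a x|) \/ p <= #|level a 1|.
Proof.
move=> pp os T2 sa; have [o [co son]] := prime_order_orbit pp os T2.
have sk k x y : (a ((s ^+ k)%g x) == a ((s ^+ k)%g y)) = (a x == a y).
  by elim: k => [|k IH]; rewrite ?expg0 ?perm1 // expgSr !permM sa.
have [e|ne] := eqVneq (a (s o)) (a o).
  left; exists o; rewrite -co; apply: subset_leq_card; apply/subsetP => x /porbitP[k ->].
  rewrite inE; elim: k => [|k IH]; first by rewrite expg0 perm1.
  by rewrite expgSr permM -e sa.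
right; rewrite -co; apply: subset_leq_card; apply/subsetP => z zo.
have nez : a (s z) != a z.
  case/porbitP: zo => k ->; apply: contra ne.
  by rewrite -!permM -expgSr expgS permM sk.
apply: level1I => w wz; apply/eqP; apply: contraT => nwz; case/negP: nez.
case: (boolP (w \in porbit s o)) => wo; last first.
  by rewrite -wz -{1}(out_perm son wo) eq_sym sa wz.
have [k ek] : exists k, w = (s ^+ k)%g z.
  apply/porbitP; move: zo wo; rewrite -!eq_porbit_mem => /eqP-> /eqP->.
  by rewrite eqxx.
have sk1 : (s ^+ k != 1)%g by apply: contra nwz => /eqP e; rewrite ek e perm1.
have : (s \in <[s ^+ k]>)%g by apply: (prime_cycle_gen pp os).
case/cycleP => m ->; elim: m => [|m IH]; first by rewrite expg0 perm1.
by rewrite expgSr permM -wz ek sk.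
Qed.

(** The symmetric group is the product of [G] and the stabiliser of the kernel. The latter has order
    prime to [p] by [prime_order_ker], so [p] divides [#|G|] and Cauchy's theorem applies. *)
Lemma ker_homogeneous_prime a p : ker_homogeneous G a -> prime p -> #|T| < 2 * p -> p <= #|T| ->
  (forall x, #|fiber a x| < p) -> #|level a 1| < p -> exists2 s, s \in G & #[s]%g = p.
Proof.
move=> aG pp T2 pT fp lp.
pose H := [set q : {perm T} | [forall x, forall y, (a (q x) == a (q y)) == (a x == a y)]].
have HP (q : {perm T}) : reflect (forall x y, (a (q x) == a (q y)) = (a x == a y)) (q \in H).
  rewrite inE; apply: (iffP forallP) => [h x y|h x]; first by have /forallP/(_ y)/eqP := h x.
  by apply/forallP => y; rewrite h.
have gH : group_set H.
  apply/group_setP; split=> [|q r /HP hq /HP hr]; apply/HP => x y; first by rewrite !perm1.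
  by rewrite !permM hr hq.
pose HG := Group gH.
have nH : ~~ (p %| #|HG|).
  apply/negP => /(Cauchy pp)[s /HP sH os].
  by have [[x]|] := prime_order_ker pp os T2 sH; rewrite leqNgt ?fp ?lp.
have GH : (G * HG)%g = setT.
  apply/eqP; rewrite eqEsubset subsetT; apply/subsetP => q _.
  have [g gG gq] := aG q; apply/mulsgP; exists g (g^-1 * q)%g => //; last by rewrite mulKVg.
  by apply/HP => x y; rewrite !permM -gq !permKV.
have cS : #|[set: {perm T}]| = #|T|`!.
  rewrite -[in RHS]cardsT -card_perm; apply: eq_card => q; rewrite inE; apply/esym.
  by apply/subsetP => x _; rewrite inE.
have := mul_cardG G HG; rewrite GH cS.
move=> e; have : p %| #|G| * #|HG| by rewrite e dvdn_mulr // dvdn_fact // prime_gt0.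
by rewrite Euclid_dvdM // (negPf nH) orbF => /(Cauchy pp)[s]; exists s.
Qed.

Lemma level_large a p x : #|T| < 2 * p -> p <= #|fiber a x| -> level a #|fiber a x| = fiber a x.
Proof.
move=> T2 px; apply/setP => y; rewrite !inE; apply/eqP/eqP => [e|e]; last first.
  by apply: eq_card => z; rewrite !inE e.
apply/eqP; apply: contraT => ne.
have : #|fiber a x :|: fiber a y| <= #|T| by apply: max_card.
rewrite cardsU e (_ : _ :&: _ = set0) ?cards0; first by clear -T2 px; lia.
apply/setP => z; rewrite !inE; apply/negP => /andP[/eqP ex /eqP ey].
by case/negP: ne; rewrite -ey ex.
Qed.

End Fibers.

(** * Antichains of kernel types *)

Section Types.
Variables (T : finType) (G : {group {perm T}}) (A : {ffun T -> T} -> Prop).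
Hypothesis A_sing : forall a, A a -> ~ injective a.
Hypothesis A_anti : forall a b, A a -> A b -> a <> b -> ~ coarser a b.
Hypothesis A_ker : forall a, A a -> ker_homogeneous G a.
Hypothesis A_top : forall a, A a -> (forall b, A b -> b <> a -> rank b < rank a) ->
  homogeneous G (rank a).

Lemma rank_gt0 a : A a -> 0 < rank a.
Proof.
move=> Aa; rewrite lt0n cards_eq0; apply/negP => /eqP e; apply: (A_sing Aa) => x.
have : a x \in [set a x | x in [set: T]] by apply: imset_f; rewrite inE.
by rewrite e inE.
Qed.

(** If [G] is intransitive, Livingstone-Wagner excludes homogeneity for all sizes strictly between 0
    and n. Then every level is empty or everything, so all classes of a kernel have one size, and
    members of equal rank are comparable. A member of maximal rank is thus alone, and [A_top] is
    contradicted. *)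
Lemma types_transitive b : A b -> homogeneous G 1.
Proof.
move=> Ab; apply: homogeneous_contra => n1.
have small k : 0 < k < #|T| -> homogeneous G k -> False.
  by move=> /andP[k0 kT] hk; apply: n1; apply: Livingstone_Wagner hk _ _; rewrite // add1n.
have lev a x y : A a -> #|fiber a x| = #|fiber a y|.
  move=> Aa; apply/eqP; apply: contraT => ne.
  exfalso; apply: (small #|level a #|fiber a x| |); last exact: level_homogeneous (A_ker Aa).
  apply/andP; split; first by apply/card_gt0P; exists x; rewrite inE.
  rewrite ltnNge; apply/negP => h.
  have E : level a #|fiber a x| = setT by apply/eqP; rewrite eqEcard subsetT cardsT.
  have : y \in level a #|fiber a x| by rewrite E inE.
  by rewrite inE eq_sym (negPf ne).
suff main m a : A a -> #|T| - rank a <= m -> False by apply: (main _ b Ab (leqnn _)).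
elim: m a => [|m IH] a Aa hm; first by have := rank_lt (A_sing Aa); clear -hm; lia.
have ra := rank_lt (A_sing Aa).
apply: (small (rank a)); first by rewrite rank_gt0.
apply: A_top => // c Ac ca; rewrite ltnNge; apply/negP => rca.
case: (ltnP (rank a) (rank c)) => rac.
  by apply: (IH c) => //; have := rank_lt (A_sing Ac); clear -rac hm ra; lia.
have re : rank c = rank a by apply/eqP; rewrite eqn_leq rac.
have [x _] : exists x : T, true.
  by have /card_gt0P[x] : 0 < #|T| by clear -ra; lia.
have uc y : #|fiber c y| = #|fiber c x| by apply: lev.
have ua y : #|fiber a y| = #|fiber a x| by apply: lev.
have fe : #|fiber a x| = #|fiber c x|.
  apply/eqP; rewrite -(eqn_pmul2l (rank_gt0 Aa)) -(uniform_card ua).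
  by rewrite -re -(uniform_card uc).
by apply: (A_anti Ac Aa ca); apply: (@coarser_uniform _ c a #|fiber c x|) => // y; rewrite ua.
Qed.

(** The conclusion of [prime_order_ker] for kernels preserved by an element of order [p]. *)
Definition extreme p (a : {ffun T -> T}) := (exists x, p <= #|fiber a x|) \/ p <= #|level a 1|.

(** A level of size at least [p] yields the rank by Livingstone-Wagner, except when [b] has one
    large class, all other classes are singletons, and the rank is one too big. Then [A_top]
    applies: a competitor [c] of rank at least that of [b] either has a smaller large class, which
    gives the missing size, or enough singletons for [coarser_hook]. *)
Lemma extreme_homogeneous p b : #|T| < 2 * p -> (forall a, A a -> extreme p a) -> A b ->
  homogeneous G (rank b).
Proof.
move=> T2 Ap Ab; apply: homogeneous_contra => nb.
have bT := ltnW (rank_lt (A_sing Ab)).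
have big a x : A a -> p <= #|fiber a x| -> homogeneous G #|fiber a x|.
  move=> Aa px; rewrite -{1}(level_large T2 px); exact: level_homogeneous (A_ker Aa).
have fT (a : {ffun T -> T}) x : #|fiber a x| <= #|T| by apply: max_card.
case: (Ap b Ab) => [[x0 px0]|pM]; last first.
  have Mr : #|level b 1| <= rank b by rewrite rank_level1 leq_addr.
  apply: nb; rewrite -(subKn bT); apply: homogeneousC; first exact: leq_subr.
  apply: (Livingstone_Wagner (level_homogeneous (A_ker Ab) (d := 1))).
    by clear -T2 pM Mr; lia.
  by clear -bT Mr; lia.
have hN := big b x0 Ab px0; have rb := rank_fiber b x0; have fb := fT b x0.
case: (leqP (rank b) (#|T| - #|fiber b x0|)) => rb'.
  by apply: nb; apply: (Livingstone_Wagner hN); clear -T2 px0 rb' fb; lia.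
have eb : rank b = (#|T| - #|fiber b x0|).+1 by apply/eqP; rewrite eqn_leq rb.
have Eb := rank_fiber_eq eb.
have cE : #|~: fiber b x0| = #|T| - #|fiber b x0| by rewrite [#|~: _|]cardsCs setCK.
have hook a : A a -> a <> b -> #|T| - #|fiber b x0| <= #|level a 1| -> False.
  move=> Aa ab le; apply: (A_anti Aa Ab ab); apply: (coarser_hook Eb); first by rewrite cE.
  by move=> x y; rewrite !inE !negbK => /eqP-> /eqP->.
apply: (nb); apply: A_top => // c Ac cb.
case: (Ap c Ac) => [[x1 px1]|pM]; last first.
  by case: (hook c Ac cb); clear -pM T2 px0 fb; lia.
have hN1 := big c x1 Ac px1; have rc := rank_fiber c x1; have fc := fT c x1.
case: (ltnP #|fiber c x1| #|fiber b x0|) => NN.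
  case: nb; apply: (Livingstone_Wagner hN1); rewrite eb; clear -NN T2 px1 px0 fb fc; lia.
rewrite ltnNge; apply/negP => rbc.
have Ne : #|fiber c x1| = #|fiber b x0| by clear -NN rbc rc eb fb fc; lia.
have ec : rank c = (#|T| - #|fiber c x1|).+1 by rewrite Ne; clear -NN rbc rc eb Ne; lia.
apply: (hook c Ac cb); rewrite -Ne.
by have := subset_leq_card (rank_fiber_eq ec); rewrite [#|~: _|]cardsCs setCK.
Qed.

(** With at most one singleton the kernel type is 1+2+3 or 2+2+2. The first has a level of size 3;
    the second is settled by [pair_kernel_homogeneous]. *)
Lemma rank3_level1 c : #|T| = 6 -> A c -> 2 < rank c ->
  homogeneous G 2 -> ~ homogeneous G 3 -> 1 < #|level c 1|.
Proof.
move=> T6 Ac rc h2 n3; rewrite ltnNge; apply/negP => l1.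
have nl d : #|level c d| <> 3.
  by move=> e; apply: n3; rewrite -e; apply: level_homogeneous (A_ker Ac).
set D := ~: level c 1.
have cD : #|D| = 6 - #|level c 1| by rewrite /D [#|~: _|]cardsCs setCK T6.
have := rank_level1 c; rewrite -/D => rE.
pose F y := #|[set x in D | c x == y]|; set I := [set c x | x in D] in rE.
have sF : #|D| = \sum_(y in I) F y := card_fibers c D.
have FE x : x \in D -> F (c x) = #|fiber c x|.
  move=> xD; apply: eq_card => z; rewrite !inE andb_idl // => /eqP e.
  by move: xD; rewrite !inE /fiber e.
clearbody F.
have f1 x : x \in D -> 1 < #|fiber c x|.
  rewrite !inE; have : 0 < #|fiber c x| by apply/card_gt0P; exists x; apply: fiber_id.
  by case: #|_| => [|[|]].
have F2 (J : {set T}) : J \subset I -> 2 * #|J| <= \sum_(y in J) F y.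
  move=> JI; rewrite mulnC -sum_nat_const; apply: leq_sum => y /(subsetP JI)/imsetP[x xD ->].
  by rewrite FE ?f1.
have I0 := F2 I (subxx _).
have [/existsP[x0 /andP[x0D Fx0]]|] := boolP [exists x, (x \in D) && (2 < #|fiber c x|)].
  have y0I : c x0 \in I by apply: imset_f.
  have sD1 := F2 (I :\ c x0) (subsetDl _ _).
  have cI := cardsD1 (c x0) I; rewrite y0I in cI.
  rewrite (big_setD1 _ y0I) /= FE // in sF I0.
  apply: (nl 3); have F3 : #|fiber c x0| = 3.
    by move: rE cI sF sD1 Fx0 l1 rc cD; clear; lia.
  rewrite -[RHS]F3; apply: eq_card => x; rewrite !inE; apply/eqP/eqP => [e|e]; last first.
    by rewrite -F3; apply: eq_card => z; rewrite !inE e.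
  apply/eqP; apply: contraT => nx.
  have xD : x \in D by rewrite !inE e.
  have xI : c x \in I :\ c x0 by rewrite !inE nx imset_f.
  have sD2 := F2 (I :\ c x0 :\ c x) (subset_trans (subsetDl _ _) (subsetDl _ _)).
  have cI2 := cardsD1 (c x) (I :\ c x0); rewrite xI in cI2.
  rewrite (big_setD1 _ xI) /= FE // e F3 in sF.
  by move: rE cI cI2 sF sD2 l1 rc cD; clear; lia.
rewrite negb_exists => /forallP h.
have e2 x : x \in D -> #|fiber c x| = 2.
  by move=> xD; apply/eqP; have := h x; rewrite xD /= -leqNgt eqn_leq f1 // andbT.
have sF2 : \sum_(y in I) F y = #|I| * 2.
  rewrite -sum_nat_const; apply: eq_bigr => y /imsetP[x xD ->]; rewrite FE // e2 //.
have l0 : level c 1 = set0.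
  by apply/eqP; rewrite -cards_eq0; move: sF sF2 l1 cD; clear; lia.
apply: n3; apply: (pair_kernel_homogeneous T6 _ (A_ker Ac) h2) => x.
by apply: e2; rewrite /D l0 setC0 inE.
Qed.

(** Only rank 3 is in doubt. There [b] has type 1+1+4, and a competitor of rank at least 3 has two
    singletons, so [coarser_hook] makes the two comparable. *)
Lemma six_homogeneous b : #|T| = 6 -> homogeneous G 2 -> A b -> homogeneous G (rank b).
Proof.
move=> T6 h2 Ab; apply: homogeneous_contra => nb.
have rT := rank_lt (A_sing Ab); have r0 := rank_gt0 Ab.
have h1 : homogeneous G 1 by apply: (Livingstone_Wagner h2); rewrite ?T6.
have r3 : rank b = 3.
  have h4 : homogeneous G 4 by have := homogeneousC (_ : 2 <= #|T|) h2; rewrite T6; apply.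
  have h5 : homogeneous G 5 by have := homogeneousC (_ : 1 <= #|T|) h1; rewrite T6; apply.
  move: nb rT r0; rewrite T6; case: (rank b) => [//|[//|[//|[//|[//|[//|m]]]]]].
  by rewrite !ltnS ltn0.
have n3 : ~ homogeneous G 3 by rewrite -r3.
have lb := rank3_level1 T6 Ab (_ : 2 < rank b) h2 n3.
have {}lb : 1 < #|level b 1| by apply: lb; rewrite r3.
have rE := rank_level1 b; rewrite r3 in rE.
have lb3 : #|level b 1| <> 3.
  by move=> e; apply: n3; rewrite -e; apply: level_homogeneous (A_ker Ab).
have : 0 < #|[set b x | x in ~: level b 1]|.
  have : 0 < #|~: level b 1| by rewrite cardsCs setCK subn_gt0 level1_lt //; apply: A_sing.
  by case/card_gt0P => x xD; apply/card_gt0P; exists (b x); apply: imset_f.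
move=> i0; have l2 : #|level b 1| = 2 by move: rE lb lb3 i0; clear; lia.
have /eqP/cards1P[y0 ey] : #|[set b x | x in ~: level b 1]| = 1 by move: rE l2; clear; lia.
apply: nb; apply: A_top => // c Ac cb; rewrite ltnNge r3; apply/negP => rc.
apply: (A_anti Ac Ab cb); apply: (coarser_hook (subxx (level b 1))).
  by rewrite l2; apply: (rank3_level1 T6 Ac rc h2 n3).
move=> x y xl yl.
have hy z : z \notin level b 1 -> b z = y0.
  move=> zl; apply/eqP; rewrite -in_set1 -ey; apply: imset_f; by rewrite in_setC.
by rewrite !hy.
Qed.

Lemma types_homogeneous b : A b -> homogeneous G (rank b).
Proof.
move=> Ab; apply: homogeneous_contra => nb.
have rT := rank_lt (A_sing Ab); have r0 := rank_gt0 Ab.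
have h1 := types_transitive Ab.
have tG : trans_on G setT.
  move=> x y _ _; have [||g gG e] := h1 [set x] [set y]; rewrite ?cards1 //.
  exists g; split=> //; first by apply/subsetP => z _; rewrite inE.
  by apply/eqP; rewrite -in_set1 -e imset_f ?inE.
have T3 : 2 < #|T|.
  rewrite ltnNge; apply/negP => T2; apply: nb.
  by have -> : rank b = 1 by move: rT r0 T2; clear; lia.
(* For n = 3, 4, 5, 7 the degree of transitivity 1 + (n - p) reaches half of n; for n = 6 the only
   candidate is 5, which gives 2-transitivity only. *)
have [p [pp T2 pT key]] : exists p, [/\ prime p, #|T| < 2 * p, p < #|T| &
    [\/ p + 3 <= #|T|, #|T|./2 <= 1 + (#|T| - p) | #|T| = 6 /\ p = 5]].
  move: T3; move: #|T| => n n3; case: (leqP 8 n) => n8.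
    have [p [pp p1 p2]] := bertrand_gap n8; exists p; split=> //; first by move: p2; clear; lia.
    by constructor 1.
  case: n n3 n8 => [|[|[|[|[|[|[|[|]]]]]]]] // _ _.
  - by exists 2; split=> //; constructor 2.
  - by exists 3; split=> //; constructor 2.
  - by exists 3; split=> //; constructor 2.
  - by exists 5; split=> //; constructor 3.
  - by exists 5; split=> //; constructor 2.
(* A member that is not extreme would put an element of order [p] into [G], and then Jordan's
   argument contradicts [nb]. *)
apply: (nb); apply: (extreme_homogeneous T2) => // a Aa.
have [/existsP[x px]|] := boolP [exists x, p <= #|fiber a x|]; first by left; exists x.
rewrite negb_exists => /forallP hf; right; rewrite leqNgt; apply/negP => lp.
have fp x : #|fiber a x| < p by rewrite ltnNge hf.
have [s sG os] := ker_homogeneous_prime (A_ker Aa) pp T2 (ltnW pT) fp lp.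
apply: nb; case: key => [p3|ph|[T6 p5]].
- exact: (Jordan_homogeneous tG pp os sG T2 p3 (ltnW rT)).
- apply: (@homogeneous_half _ _ #|T|./2); try by clear -rT; lia.
  exact: seq_trans_homogeneous (Jordan_prime tG pp os sG T2) ph.
apply: six_homogeneous => //.
apply: seq_trans_homogeneous (Jordan_prime tG pp os sG T2) _.
by rewrite T6 p5.
Qed.

End Types.

(** * Semigroups of transformations *)

Lemma uniq_map_inj_in (T R : eqType) (f : T -> R) (s : seq T) :
  uniq (map f s) -> {in s &, injective f}.
Proof.
elim: s => [|x s IH] //= /andP[xs us] y z; rewrite !inE.
move=> /predU1P[->|ys] /predU1P[->|zs] // e; last exact: IH e.
  by rewrite e map_f in xs.
by rewrite -e map_f in xs.
Qed.

Section Sets.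
Variables (T : finType) (a : {ffun T -> T}).

Lemma inj_in_perm (S : {set T}) (f : T -> T) : {in S &, injective f} ->
  exists q : {perm T}, {in S, forall x, q x = f x}.
Proof.
move=> fi; have [|||q e] := @perm_extends T (enum S) (map f (enum S)).
- exact: enum_uniq.
- by rewrite map_inj_in_uniq ?enum_uniq // => x y; rewrite !mem_enum; apply: fi.
- by rewrite size_map.
by exists q => x xS; move/eq_in_map: e; apply; rewrite mem_enum.
Qed.

(** Send [u] and [v] to two points of one class of [a], and [D] into the list [L] of representatives
    of the other classes, of which there are enough by [#|D| < rank a]. *)
Lemma merge_perm u v (D : {set T}) : ~ injective a -> u != v -> u \notin D -> v \notin D ->
  #|D| < rank a -> exists q : {perm T}, a (q u) = a (q v) /\
    {in u |: D &, forall s t, a (q s) = a (q t) -> s = t}.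
Proof.
move=> na uv uD vD Dr.
have [x [y [xy axy]]] : exists x y, x != y /\ a x = a y.
  case: (boolP [exists x, exists y, (x != y) && (a x == a y)]).
    by case/existsP=> x /existsP[y /andP[xy /eqP axy]]; exists x, y.
  move=> h; case: na => x y axy; apply/eqP; apply: contraNT h => xy.
  by apply/existsP; exists x; apply/existsP; exists y; rewrite xy axy /=.
pose I := [set a z | z in [set: T]].
pose L := [seq odflt x [pick w | a w == z] | z <- enum (I :\ a x)].
have aL : map a L = enum (I :\ a x).
  rewrite -map_comp -[RHS]map_id; apply/eq_in_map => z; rewrite mem_enum !inE => /andP[_].
  case/imsetP => w _ -> /=; case: pickP => [w' /eqP //|/(_ w)]; by rewrite /= eqxx.
have sL : #|D| <= size L.
  rewrite size_map -cardE -ltnS; apply: leq_trans Dr _.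
  by rewrite /rank -/I (cardsD1 (a x)) imset_f ?inE.
have uL : uniq (map a (x :: take #|D| L)).
  rewrite /= map_take aL take_uniq ?enum_uniq // andbT.
  by apply/negP => /mem_take; rewrite mem_enum !inE eqxx.
have [|||q [qu qv qD]] := @perm_extends T (u :: v :: enum D) (x :: y :: take #|D| L).
- by rewrite /= !inE !mem_enum negb_or uv uD vD enum_uniq.
- have /= /andP[xL uL'] := uL; rewrite inE negb_or xy (map_uniq uL') andbT.
  have nL z : a z = a x -> z \notin take #|D| L.
    by move=> e; apply: contra xL; rewrite -e; apply: map_f.
  by rewrite !nL.
- by rewrite /= size_take_min -cardE (minn_idPl sL).
exists q; split; first by rewrite qu qv.
have uq : uniq (map (a \o q) (u :: enum D)) by rewrite map_comp /= qu qD.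
move=> s t sD tD e.
have mE z : z \in u |: D -> z \in u :: enum D by rewrite !inE mem_enum.
by apply: (uniq_map_inj_in uq); rewrite ?mE.
Qed.
End Sets.

Section Composition.
Variable n : nat.
Implicit Types f g h a b : trans n.
Implicit Types p q : {perm 'I_n}.
Implicit Types X A : trans n -> Prop.

Lemma tcompE f g i : tcomp f g i = f (g i). Proof. by rewrite ffunE. Qed.

Lemma perm_transE p i : perm_trans p i = p i. Proof. by rewrite ffunE. Qed.

Lemma tcompA f g h : tcomp f (tcomp g h) = tcomp (tcomp f g) h.
Proof. by apply/ffunP => i; rewrite !tcompE. Qed.

Lemma tcomp1f f : tcomp (perm_trans 1%g) f = f.
Proof. by apply/ffunP => i; rewrite tcompE perm_transE perm1. Qed.

Lemma tcompf1 f : tcomp f (perm_trans 1%g) = f.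
Proof. by apply/ffunP => i; rewrite tcompE perm_transE perm1. Qed.

Lemma perm_transM p q : perm_trans (p * q)%g = tcomp (perm_trans q) (perm_trans p).
Proof. by apply/ffunP => i; rewrite tcompE !perm_transE permM. Qed.

Lemma inSnP f : inSn f -> exists p, f = perm_trans p.
Proof. by move=> fi; exists (perm fi); apply/ffunP => i; rewrite perm_transE permE. Qed.

Lemma perm_trans_inSn p : inSn (perm_trans p).
Proof. by move=> i j; rewrite !perm_transE => /perm_inj. Qed.

Lemma inG_inSn (G : {group {perm 'I_n}}) f : inG G f -> inSn f.
Proof. by case=> p _ ->; apply: perm_trans_inSn. Qed.

Lemma inSn_comp f g : inSn f -> inSn g -> inSn (tcomp f g).
Proof. by move=> fi gi i j; rewrite !tcompE => /fi/gi. Qed.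

Lemma inSn_compr f g : inSn (tcomp f g) -> inSn g.
Proof. by move=> fg i j e; apply: fg; rewrite !tcompE e. Qed.

Lemma inSn_compl f g : inSn (tcomp f g) -> inSn f.
Proof.
move=> fg; have [p e] := inSnP (inSn_compr fg).
have -> : f = tcomp (tcomp f g) (perm_trans p^-1%g).
  by apply/ffunP => i; rewrite !tcompE e !perm_transE permKV.
exact: (inSn_comp fg (@perm_trans_inSn _)).
Qed.

Lemma imset_tcomp f g :
  [set tcomp f g x | x in [set: 'I_n]] = [set f y | y in [set g x | x in [set: 'I_n]]].
Proof. by rewrite -imset_comp; apply: eq_imset => x; rewrite tcompE. Qed.

Lemma rank_compr f g : rank (tcomp f g) <= rank g.
Proof. by rewrite /rank imset_tcomp leq_imset_card. Qed.

Lemma rank_compl f g : rank (tcomp f g) <= rank f.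
Proof. by rewrite /rank imset_tcomp subset_leq_card // imsetS // subsetT. Qed.

Lemma rank_perml p f : rank (tcomp (perm_trans p) f) = rank f.
Proof.
apply/eqP; rewrite eqn_leq rank_compr /=.
have {1}-> : f = tcomp (perm_trans p^-1%g) (tcomp (perm_trans p) f).
  by apply/ffunP => i; rewrite !tcompE !perm_transE permK.
exact: rank_compr.
Qed.

Lemma gen_mono X Y f : (forall g, X g -> Y g) -> gen X f -> gen Y f.
Proof. by move=> XY; elim=> [g /XY|g h _ IH1 _ IH2]; [apply: gen_base|apply: gen_comp]. Qed.

Lemma gen_perm A p : gen (withSn A) (perm_trans p).
Proof. by apply: gen_base; right; apply: perm_trans_inSn. Qed.

Lemma gen_inG A (G : {group {perm 'I_n}}) p : p \in G -> gen (withG A G) (perm_trans p).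
Proof. by move=> pG; apply: gen_base; right; exists p. Qed.

(** The members of [G] applied before the first letter from [A] are collected in [p]. *)
Lemma gen_first A (G : {group {perm 'I_n}}) f : gen (withG A G) f -> inG G f \/
  exists a p g, [/\ A a, p \in G & f = tcomp g (tcomp a (perm_trans p))].
Proof.
elim=> [g [Ag|gG]|g h _ IH1 _ IH2]; last 1 first.
- case: IH2 => [[q qG ->]|[a [p [w [Aa pG ->]]]]]; last first.
    by right; exists a, p, (tcomp g w); split=> //; rewrite !tcompA.
  case: IH1 => [[p pG ->]|[a [p [w [Aa pG ->]]]]].
    by left; exists (q * p)%g; rewrite ?groupM ?perm_transM.
  by right; exists a, (q * p)%g, w; rewrite groupM // perm_transM !tcompA.
- by right; exists g, 1%g, (perm_trans 1%g); rewrite group1 tcomp1f tcompf1.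
- by left.
Qed.

Lemma gen_last A (G : {group {perm 'I_n}}) f : gen (withG A G) f -> inG G f \/
  exists a p g, [/\ A a, p \in G & f = tcomp (perm_trans p) (tcomp a g)].
Proof.
elim=> [g [Ag|gG]|g h _ IH1 _ IH2]; last 1 first.
- case: IH1 => [[q qG ->]|[a [p [w [Aa pG ->]]]]]; last first.
    by right; exists a, p, (tcomp w h); split=> //; rewrite !tcompA.
  case: IH2 => [[p pG ->]|[a [p [w [Aa pG ->]]]]].
    by left; exists (p * q)%g; rewrite ?groupM ?perm_transM.
  by right; exists a, (p * q)%g, w; rewrite groupM // perm_transM !tcompA.
- by right; exists g, 1%g, (perm_trans 1%g); rewrite group1 tcomp1f tcompf1.
- by left.
Qed.

Lemma gen_singular A (G : {group {perm 'I_n}}) f : (forall a, A a -> ~ inSn a) ->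
  gen (withG A G) f -> ~ inG G f -> gen (withSn A) f /\ ~ inSn f.
Proof.
move=> sA gf nf; split.
  by apply: gen_mono gf => g [|/inG_inSn]; [left | right].
move=> fi; case: (gen_first gf) => // [[a [p [w [Aa _ ef]]]]].
by apply: (sA a Aa); move: fi; rewrite ef => /inSn_compr/inSn_compl.
Qed.

(* Writing [h] on the image of [f] as a composite of a permutation with maps [a \o q] that merge
   two points each. *)
Lemma gen_postcomp a f h : ~ inSn a -> gen (withSn (fun g => g = a)) f -> rank f <= rank a ->
  gen (withSn (fun g => g = a)) (tcomp h f).
Proof.
move=> na; move fm: (rank f) => m; elim/ltn_ind: m f h fm => m IH f h fm gf fr.
set S := [set f x | x in [set: 'I_n]].
have fS i : f i \in S by rewrite imset_f ?inE.
case: (boolP [exists u in S, exists v in S, (u != v) && (h u == h v)]); last first.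
  move=> hi; have [u v uS vS e|p hp] := @inj_in_perm _ S h.
    apply/eqP; apply: contraNT hi => uv.
    by apply/exists_inP; exists u => //; apply/exists_inP; exists v; rewrite ?uv ?e //=.
  have -> : tcomp h f = tcomp (perm_trans p) f.
    by apply/ffunP => i; rewrite !tcompE perm_transE hp.
  by apply: gen_comp gf; apply: gen_perm.
case/exists_inP => u uS /exists_inP[v vS /andP[uv /eqP huv]].
have vS' : v \in S :\ u by rewrite !inE eq_sym uv.
have cS : #|S| = (#|S :\ u :\ v|).+2.
  by have := cardsD1 u S; have := cardsD1 v (S :\ u); rewrite uS vS' => -> ->.
have [|||q [quv qi]] := @merge_perm _ a u v (S :\ u :\ v) na uv.
- by rewrite !inE eqxx andbF.
- by rewrite !inE eqxx.
- by apply: leq_trans fr; rewrite -fm /rank -/S cS.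
pose e := tcomp a (perm_trans q).
have eE i : e i = a (q i) by rewrite tcompE perm_transE.
have eh s t : s \in S -> t \in S -> e s = e t -> h s = h t.
  have can z : z \in S -> exists2 z', z' \in u |: (S :\ u :\ v) & e z = e z' /\ h z = h z'.
    move=> zS; case: (z =P v) => [->|/eqP zv].
      by exists u; rewrite ?inE ?eqxx // !eE quv huv.
    by exists z => //; rewrite !inE zv zS; case: (z == u).
  case/can=> s' s'D [es hs] /can[t' t'D [et ht]] e'; rewrite hs ht; congr (h _).
  by apply: qi => //; rewrite -!eE -es -et.
(* By [eh], [h] factors through [e] on the image [S] of [f]; the default [z] occurs only outside the
   image of [S] under [e]. *)
pose h' : trans n := [ffun z => if [pick w in S | e w == z] is Some w then h w else z].
have -> : tcomp h f = tcomp h' (tcomp e f).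
  apply/ffunP => i; rewrite !tcompE ffunE; case: pickP => [w /andP[wS /eqP we]|/(_ (f i))].
    by apply: eh => //; rewrite we ?tcompE.
  by rewrite fS tcompE eqxx.
have re : rank (tcomp e f) < m.
  rewrite -fm ltn_neqAle rank_compr andbT; apply/negP; rewrite /rank imset_tcomp -/S.
  by move=> /imset_injP ei; case/eqP: uv; apply: ei => //; rewrite !eE.
apply: (IH _ re _ h' erefl); last by apply: leq_trans fr; apply: ltnW.
apply: gen_comp gf; apply: gen_comp (gen_perm _ _).
by apply: gen_base; left.
Qed.

Lemma coarser_gen a b : ~ inSn a -> coarser a b -> gen (withSn (fun g => g = a)) b.
Proof.
move=> na [h [q hq]].
have -> : b = tcomp [ffun x => h x] (tcomp a (perm_trans q)).
  by apply/ffunP => i; rewrite tcompE ffunE hq tcompE perm_transE.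
apply: gen_postcomp (rank_compl _ _) => //.
by apply: gen_comp (gen_perm _ _); apply: gen_base; left.
Qed.

Lemma sing_comp p a q : ~ inSn a -> ~ inSn (tcomp (perm_trans p) (tcomp a (perm_trans q))).
Proof. by move=> na /inSn_compr/inSn_compl. Qed.

Lemma gen_sandwich A a p q : A a ->
  gen (withSn A) (tcomp (perm_trans p) (tcomp a (perm_trans q))).
Proof.
move=> Aa; apply: gen_comp (gen_perm _ _) (gen_comp _ (gen_perm _ _)).
by apply: gen_base; left.
Qed.

Lemma gen_sandwich_all A X :
  (forall a p q, A a -> gen X (tcomp (perm_trans p) (tcomp a (perm_trans q)))) ->
  forall f, gen (withSn A) f -> ~ inSn f -> gen X f.
Proof.
move=> AX f Af nf.
(* Keeping the outer permutations free lets permutation factors be absorbed, so the induction passes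
   through products. *)
have [//|h] : inSn f \/ forall p q, gen X (tcomp (perm_trans p) (tcomp f (perm_trans q))).
  elim: Af => [g [Ag|gS]|g h _ IH1 _ IH2]; [by right=> p q; apply: AX|by left|].
  case: IH1 IH2 => [gS|IH1] [hS|IH2]; first by left; apply: inSn_comp.
  - right=> p q; have [r ->] := inSnP gS.
    by have := IH2 (r * p)%g q; rewrite perm_transM !tcompA.
  - right=> p q; have [r ->] := inSnP hS.
    by have := IH1 p (q * r)%g; rewrite perm_transM !tcompA.
  - right=> p q; have := gen_comp (IH1 p 1%g) (IH2 1%g q).
    by rewrite tcomp1f tcompf1 !tcompA.
by have := h 1%g 1%g; rewrite tcomp1f tcompf1.
Qed.

(** * Sufficient conditions for an S_n-pair *)

Section Pairs.
Variable G : {group {perm 'I_n}}.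

Lemma postcomp_perm (f f' : trans n) : (forall x y, (f x == f y) = (f' x == f' y)) ->
  exists p, f = tcomp (perm_trans p) f'.
Proof.
move=> e; pose S := [set f' x | x in [set: 'I_n]].
pose h z := if [pick x | f' x == z] is Some x then f x else z.
have hf x : h (f' x) = f x.
  by rewrite /h; case: pickP => [y|/(_ x)]; [rewrite -e => /eqP | rewrite eqxx].
have [x y|p hp] := @inj_in_perm _ S h.
  by move=> /imsetP[u _ ->] /imsetP[v _ ->]; rewrite !hf => /eqP; rewrite e => /eqP.
by exists p; apply/ffunP => x; rewrite tcompE perm_transE hp ?hf // imset_f ?inE.
Qed.

(* The map [a \o g] identifies [u] and [v] and is injective elsewhere on the images of [f] and of
   [tperm u v \o f]; a power of [g' \o a \o g] restores the image of the latter. *)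
Lemma gen_exchange a f u v : ~ inSn a -> ker_homogeneous G a -> homogeneous G (rank a) ->
  rank f = rank a -> u \in [set f x | x in [set: 'I_n]] -> v \notin [set f x | x in [set: 'I_n]] ->
  gen (withG (fun g => g = a) G) f ->
  gen (withG (fun g => g = a) G) (tcomp (perm_trans (tperm u v)) f).
Proof.
set S := [set f x | x in [set: 'I_n]]; set X := withG _ _.
move=> na aG hG fr uS vS gf.
have uv : u != v by apply: contraNneq vS => <-.
have [|||q [quv qi]] := merge_perm na uv (_ : u \notin S :\ u) (_ : v \notin S :\ u).
- by rewrite !inE eqxx.
- by rewrite !inE (negPf vS) andbF.
- by rewrite -fr /rank -/S (cardsD1 u S) uS.
have [g gG gq] := aG q.
have guv : a (g u) = a (g v) by apply/eqP; rewrite gq quv.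
have gi s t : s \in S -> t \in S -> a (g s) = a (g t) -> s = t.
  move=> sS tS /eqP; rewrite gq => /eqP; apply: qi; by rewrite setD1K.
pose f' := tcomp (perm_trans (tperm u v)) f.
have f'E i : f' i = tperm u v (f i) by rewrite tcompE perm_transE.
have fS i : f i \in S by rewrite imset_f ?inE.
have agf i : a (g (f' i)) = a (g (f i)).
  rewrite f'E; case: tpermP => // e; first by rewrite e guv.
  by have := fS i; rewrite e (negPf vS).
have [||g' g'G g'S] := hG [set a x | x in [set: 'I_n]] [set f' x | x in [set: 'I_n]] => //.
  by rewrite -[LHS]/(rank f') rank_perml fr.
pose phi := tcomp (perm_trans g') (tcomp a (perm_trans g)).
have phiE i : phi i = g' (a (g i)) by rewrite !tcompE !perm_transE.
have gphi : gen X phi.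
  apply: gen_comp (gen_inG _ g'G) (gen_comp _ (gen_inG _ gG)).
  by apply: gen_base; left.
have phif : gen X (tcomp phi f').
  have -> : tcomp phi f' = tcomp phi f.
    by apply/ffunP => i; rewrite 2!(tcompE phi) !phiE agf.
  exact: gen_comp gphi gf.
clearbody phi; set S' := [set f' x | x in [set: 'I_n]] in g'S.
have phiS i : phi i \in S' by rewrite phiE -g'S imset_f // imset_f ?inE.
have [x y|psi hpsi] := @inj_in_perm _ S' phi.
  case/imsetP => i _ -> /imsetP[j _ ->]; rewrite !phiE => /perm_inj; rewrite !agf => e.
  by rewrite !f'E (gi _ _ (fS i) (fS j) e).
have f'S i : f' i \in S' by rewrite imset_f ?inE.
have it k i : (psi ^+ k)%g (f' i) \in S'.
  elim: k => [|k IH]; first by rewrite expg0 perm1.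
  by rewrite expgSr permM hpsi.
have main k : gen X (tcomp (perm_trans (psi ^+ k.+1)%g) f').
  elim: k => [|k IH].
    have -> : tcomp (perm_trans (psi ^+ 1)%g) f' = tcomp phi f' => //.
    by apply/ffunP => i; rewrite (tcompE phi) tcompE perm_transE expg1 (hpsi _ (f'S i)).
  have -> : tcomp (perm_trans (psi ^+ k.+2)%g) f' =
      tcomp phi (tcomp (perm_trans (psi ^+ k.+1)%g) f').
    apply/ffunP => i; rewrite (tcompE phi) !(tcompE (perm_trans _) f') !perm_transE.
    by rewrite expgSr permM (hpsi _ (it _ i)).
  exact: gen_comp gphi IH.
(* [main] covers the positive powers; the order of [psi] is one of them. *)
have := main (#[psi]%g.-1); rewrite prednK ?order_gt0 // expg_order.
by rewrite tcomp1f.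
Qed.

(** If the image of [f] contains neither point, nothing changes; if it contains one, this is
    [gen_exchange]. If it contains both, a free point [w] exists since [rank a] is less than n, and
    three exchanges suffice: [u] to [w], [v] to [u], [w] to [v]. *)
Lemma gen_tperm a f u v : ~ inSn a -> ker_homogeneous G a -> homogeneous G (rank a) ->
  rank f = rank a -> gen (withG (fun g => g = a) G) f ->
  gen (withG (fun g => g = a) G) (tcomp (perm_trans (tperm u v)) f).
Proof.
move=> na aG hG; set X := withG _ _.
set S := fun f : trans n => [set f x | x in [set: 'I_n]].
have ex f1 u1 v1 : rank f1 = rank a -> u1 \in S f1 -> v1 \notin S f1 -> gen X f1 ->
  gen X (tcomp (perm_trans (tperm u1 v1)) f1) by apply: gen_exchange.
move=> fr gf.
have fS f1 i : f1 i \in S f1 by rewrite imset_f ?inE.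
have mS f1 p x : (p x \in S (tcomp (perm_trans p) f1)) = (x \in S f1).
  rewrite /S imset_tcomp (eq_imset _ (perm_transE p)).
  by rewrite mem_imset //; apply: perm_inj.
case: (boolP (u \in S f)) (boolP (v \in S f)) => uS [] vS; last 1 first.
- suff -> : tcomp (perm_trans (tperm u v)) f = f by [].
  apply/ffunP => i; rewrite tcompE perm_transE tpermD //.
    by apply: contraNneq uS => ->.
  by apply: contraNneq vS => ->.
- have [->|uv] := eqVneq u v.
    by rewrite tperm1 tcomp1f.
  have [w wS] : exists w, w \notin S f.
    have /card_gt0P[w] : 0 < #|~: S f|.
      rewrite cardsCs setCK subn_gt0 -/(rank f) fr; exact: rank_lt na.
    by rewrite inE; exists w.
  have uw : u != w by apply: contraNneq wS => <-.
  have vw : v != w by apply: contraNneq wS => <-.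
  have wv : w != v by rewrite eq_sym.
  have s1 := ex f u w fr uS wS gf; set f1 := tcomp _ f in s1.
  have r1 : rank f1 = rank a by rewrite rank_perml.
  have u1 : u \notin S f1 by rewrite -[u](tpermR u w) mS.
  have v1 : v \in S f1 by rewrite -(tpermD uv wv) mS.
  have s2 := ex f1 v u r1 v1 u1 s1; set f2 := tcomp _ f1 in s2.
  have r2 : rank f2 = rank a by rewrite rank_perml.
  have w1 : w \in S f1 by rewrite -[w](tpermL u w) mS.
  have w2 : w \in S f2 by rewrite -(tpermD vw uw) mS.
  have v2 : v \notin S f2 by rewrite -[v](tpermR v u) mS.
  have := ex f2 w v r2 w2 v2 s2.
  suff -> : tcomp (perm_trans (tperm w v)) f2 = tcomp (perm_trans (tperm u v)) f by [].
  apply/ffunP => i; rewrite !tcompE !perm_transE.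
  have [eu|nu] := eqVneq (f i) u.
    by rewrite eu !tpermL (tpermD vw uw) tpermL.
  have [ev|nv] := eqVneq (f i) v.
    by rewrite ev (tpermD uv wv) tpermL tpermR tpermD // eq_sym.
  have nw : w != f i by apply: contraNneq wS => ->.
  by rewrite !tpermD // eq_sym.
- exact: ex.
- by rewrite tpermC; apply: ex.
Qed.

Lemma gen_left_perm a t : ~ inSn a -> ker_homogeneous G a -> homogeneous G (rank a) ->
  gen (withG (fun g => g = a) G) (tcomp (perm_trans t) a).
Proof.
move=> na aG hG; have [ts -> _] := prod_tpermP t.
suff main s : gen (withG (fun g => g = a) G) (tcomp (perm_trans s) a) ->
    gen (withG (fun g => g = a) G)
      (tcomp (perm_trans (s * \prod_(x <- ts) tperm x.1 x.2)%g) a).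
  by have := main 1%g; rewrite mul1g; apply; rewrite tcomp1f; apply: gen_base; left.
elim: ts s => [|[u v] ts IH] s gs; first by rewrite big_nil mulg1.
rewrite big_cons mulgA; apply: IH.
by rewrite perm_transM -tcompA; apply: gen_tperm => //; rewrite rank_perml.
Qed.

(** In [p \o a \o q], replace [q] by some [g] in [G] giving the same kernel, at the cost of a
    permutation on the left; left permutations are produced by [gen_left_perm]. *)
Lemma Sn_pair_suff a : ~ inSn a -> ker_homogeneous G a -> homogeneous G (rank a) -> Sn_pair a G.
Proof.
move=> na aG hG f; split=> [[gf nf]|[gf nf]].
  by apply: (gen_singular _ gf nf) => _ ->.
split; last by move=> /inG_inSn.
apply: (gen_sandwich_all _ gf nf) => _ p q ->.
have [g gG gq] := aG q.
have [|t et] := @postcomp_perm (tcomp a (perm_trans q)) (tcomp a (perm_trans g)).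
  by move=> x y; rewrite !tcompE !perm_transE gq.
rewrite et !tcompA -perm_transM.
by apply: gen_comp (gen_left_perm _ _ _ _) (gen_inG _ gG).
Qed.

End Pairs.

(** * Consequences of generation by [A] and [G] *)

Section Generation.
Variables (A : trans n -> Prop) (G : {group {perm 'I_n}}).
Hypothesis A_ind : independent A.
Hypothesis AG : forall f, (gen (withG A G) f /\ ~ inG G f) <-> (gen (withSn A) f /\ ~ inSn f).

Lemma independent_anti a b : A a -> A b -> a <> b -> ~ coarser a b.
Proof.
case: A_ind => sA iA Aa Ab ab /(coarser_gen (sA a Aa)).
by apply: iA => // e; apply: ab.
Qed.

Lemma gen_withG_sandwich a p q : A a -> let f := tcomp (perm_trans p) (tcomp a (perm_trans q)) in
  gen (withG A G) f /\ ~ inG G f.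
Proof.
move=> Aa; apply/AG; split; first exact: gen_sandwich.
by apply: sing_comp; case: A_ind => sA _; apply: sA.
Qed.

(** In a word for [a \o q], the first letter [b] from [A] satisfies [coarser b a], so it is [a]. By
    ranks, what follows is injective on the image of [a], so the group element before that letter
    induces the kernel of [a \o q]. *)
Lemma gen_ker_homogeneous a : A a -> ker_homogeneous G a.
Proof.
move=> Aa q; have [gf nf] := gen_withG_sandwich 1%g q Aa; rewrite tcomp1f in gf nf.
case: (gen_first gf) => // [[b [g [w [Ab gG e]]]]].
have eE x : a (q x) = w (b (g x)).
  by have /ffunP/(_ x) := e; rewrite !tcompE !perm_transE.
have ba : b = a.
  apply/eqP; apply: contraT => /eqP ne; case: (independent_anti Ab Aa ne).
  by exists w, (q^-1 * g)%g => x; rewrite permM -eE permKV.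
rewrite {b Ab}ba in e eE; exists g => // x y; rewrite !eE.
have wi : {in [set a x | x in [set: 'I_n]] &, injective w}.
  apply/imset_injP; rewrite eqn_leq leq_imset_card /= -imset_tcomp.
  rewrite -[X in X <= _]/(rank a).
  have {1}-> : a = tcomp (tcomp w a) (perm_trans (q^-1 * g)%g).
    by apply/ffunP => z; rewrite !tcompE perm_transE permM -eE permKV.
  exact: rank_compl.
by apply/eqP/eqP => [->|/wi ->] //; rewrite imset_f ?inE.
Qed.

(** In a word for [p \o a], the last letter from [A] has rank at least [rank a], so it is [a]; the
    group element after it carries the image of [a] onto that of [p \o a]. *)
Lemma gen_top_homogeneous a : A a -> (forall b, A b -> b <> a -> rank b < rank a) ->
  homogeneous G (rank a).
Proof.
move=> Aa top; pose I := [set a x | x in [set: 'I_n]].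
have one (S : {set 'I_n}) : #|S| = rank a ->
    exists2 g : {perm 'I_n}, g \in G & [set g x | x in I] = S.
  move=> cS; have [p pI] := @perm_imset_extends _ I S (eq_leq (esym cS)).
  have {}pI : [set p x | x in I] = S.
    by apply/eqP; rewrite eqEcard pI (card_imset _ (@perm_inj _ p)) cS leqnn.
  have [gf nf] := gen_withG_sandwich p 1%g Aa; rewrite tcompf1 in gf nf.
  case: (gen_last gf) => // [[b [g [w [Ab gG e]]]]].
  have ba : b = a.
    apply/eqP; apply: contraT => /eqP ne; have := top b Ab ne.
    rewrite ltnNge -(rank_perml p a) e rank_perml => /negP[].
    exact: rank_compl.
  exists g => //; rewrite {b Ab}ba in e.
  apply/esym/eqP; rewrite eqEcard (card_imset _ (@perm_inj _ g)) cS leqnn andbT -pI.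
  have := congr1 (fun f : trans n => [set f x | x in [set: 'I_n]]) e.
  rewrite !imset_tcomp !(eq_imset _ (perm_transE _)) => ->.
  by apply: imsetS; apply: imsetS; apply: subsetT.
move=> S R cS cR; have [g gG gS] := one S cS; have [h hG hR] := one R cR.
exists (g^-1 * h)%g; first by rewrite groupM ?groupV.
by rewrite -gS -imset_permM mulKVg.
Qed.

Lemma gen_Sn_pair a : A a -> Sn_pair a G.
Proof.
move=> Aa; have sA : forall a, A a -> ~ inSn a by case: A_ind.
apply: Sn_pair_suff; [exact: sA | exact: gen_ker_homogeneous |].
exact: (types_homogeneous sA independent_anti gen_ker_homogeneous gen_top_homogeneous).
Qed.

End Generation.
End Composition.

Theorem theorem8p4 (n : nat) (A : trans n -> Prop) (G : {group {perm 'I_n}}) :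
  independent A ->
  ((forall f,
      (gen (withG A G) f /\ ~ inG G f)
      <-> (gen (withSn A) f /\ ~ inSn f))
   <-> (forall a, A a -> Sn_pair a G)).
Proof.
move=> A_ind; have sA : forall a, A a -> ~ inSn a by case: A_ind.
split=> [AG a Aa|AG f]; first exact: gen_Sn_pair AG _ Aa.
split=> [[gf nf]|[gf nf]]; first exact: gen_singular gf nf.
split; last by move=> /inG_inSn.
(* Only the maps [p \o a \o q] need to be generated, and each already lies in the semigroup of its
   own pair. *)
apply: (gen_sandwich_all _ gf nf) => a p q Aa.
have [|ga _] := proj2 (AG a Aa (tcomp (perm_trans p) (tcomp a (perm_trans q)))).
  by split; [apply: gen_sandwich | apply: sing_comp; apply: sA].
by apply: gen_mono ga => g [->|?]; [left | right].
Qed.
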